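(* Let $\mathcal{A}=\{\alpha_1,\dots,\alpha_n\}$ be an irreducible vector configuration in $\mathbb{R}^d$. Let $\mathcal{M}_{[\mathcal{A}]}$ be the moduli space of Euclidean $\vee$-systems projectively equivalent to $\mathcal{A}$ up to orthogonal projective equivalence, let $P(\mathcal{A})\subset\mathbb{R}^n$ be the base polytope of $\mathcal{A}$, and let $\ker Q\subset\mathbb{R}^n$ be the kernel of the Hirzebruch quadratic form $Q$ of the hyperplane arrangement $\Delta_{\mathcal{A}}=\{\alpha_1^\perp,\dots,\alpha_n^\perp\}$. Then $\mathcal{M}_{[\mathcal{A}]}$ is homeomorphic to $$\mathrm{relin}(P(\mathcal{A}))\cap\ker Q,$$ where $\mathrm{relin}(P(\mathcal{A}))$ is the interior of $P(\mathcal{A})$ in its affine hull. In particular $\mathcal{M}_{[\mathcal{A}]}$ is homeomorphic to the (relative) interior of a (possibly empty) polytope.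
   Context: $\mathbb{R}^d$ carries its standard Euclidean inner product $(\cdot,\cdot)$. Vector configuration in $\mathbb{R}^d$: a finite (indexed) set $\mathcal{A}=\{\alpha_1,\dots,\alpha_n\}$ of non-zero, pairwise non-proportional vectors that span $\mathbb{R}^d$. It is reducible if there is a non-trivial direct sum decomposition $\mathbb{R}^d=P\oplus P'$ with $\mathcal{A}=(\mathcal{A}\cap P)\cup(\mathcal{A}\cap P')$, and irreducible otherwise. Euclidean $\vee$-system in $\mathbb{R}^d$: a finite set $\mathcal{A}=\{\alpha_1,\dots,\alpha_n\}\subset\mathbb{R}^d\setminus\{0\}$ of pairwise non-proportional vectors such that: (V1) $\sum_{i=1}^n (x,\alpha_i)^2=|x|^2$ for all $x\in\mathbb{R}^d$; (V2) for every linear $2$-plane $\Pi\subset\mathbb{R}^d$ with $|\mathcal{A}\cap\Pi|\ge 3$ there is $\nu(\Pi)\in\mathbb{R}$ with $\sum_{i:\alpha_i\in\Pi}(x,\alpha_i)^2=\nu(\Pi)|x|^2$ for all $x\in\Pi$; (V3) for every linear $2$-plane $\Pi$ with $\mathcal{A}\cap\Pi=\{\alpha_i,\alpha_j\}$, $i\ne j$, one has $(\alpha_i,\alpha_j)=0$. Moduli space: identify an indexed configuration with the $d\times n$ matrix $[\alpha_1,\dots,\alpha_n]$ of its columns. Let $[\mathcal{A}]\subset\mathbb{R}^{d\times n}$ be the set of all configurations projectively equivalent to $\mathcal{A}$, i.e. of the form $[\lambda_1F(\alpha_1),\dots,\lambda_nF(\alpha_n)]$ with $F\in\mathrm{GL}(d,\mathbb{R})$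 and $\lambda_i\in\mathbb{R}\setminus\{0\}$. Let $V_{n,d}\subset\mathbb{R}^{d\times n}$ be the set of matrices whose columns form a Euclidean $\vee$-system of $n$ vectors in $\mathbb{R}^d$. The group $K=\{\pm1\}^n\times\mathrm{O}(d)$ acts by $((\epsilon_i),G)\cdot[\alpha_1,\dots,\alpha_n]=[\epsilon_1G(\alpha_1),\dots,\epsilon_nG(\alpha_n)]$ (its orbits are the orthogonal projective equivalence classes). Then $\mathcal{M}_{[\mathcal{A}]}=(V_{n,d}\cap[\mathcal{A}])/K$ with the quotient topology (of the subspace topology). Base polytope: $P(\mathcal{A})\subset\mathbb{R}^n$ is the convex hull of the $0/1$ indicator vectors $\mathbf{1}_I$ of all subsets $I\subset\{1,\dots,n\}$ with $|I|=d$ such that $\{\alpha_i:i\in I\}$ is a basis of $\mathbb{R}^d$. Hirzebruch quadratic form: for a finite set $\mathcal{H}=\{H_1,\dots,H_n\}$ of pairwise distinct linear hyperplanes in $\mathbb{R}^d$, let $\mathcal{G}$ be the set of codimension-$2$ linear subspaces $S$ that are the common intersection of $3$ or more hyperplanes in $\mathcal{H}$; let $w_S=\frac12\sum_{i:S\subset H_i}w_i$ for $S\in\mathcal{G}$; and let $\sigma_i$ be the number of $S\in\mathcal{G}$ with $S\subset H_i$. The Hirzebruch quadratic form of $\mathcal{H}$ is $$Q(w_1,\dots,w_n)=\sum_{S\in\mathcal{G}}w_S^2-\frac12\sum_{i=1}^n(\sigma_i-1)w_i^2-\frac1{2d}\Big(\sum_{i=1}^n w_i\Big)^2 .$$ Its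 kernel $\ker Q$ is the kernel (radical) of the associated symmetric bilinear form. *)

(* Defs.v *)
From HB Require Import structures.
From mathcomp Require Import all_boot all_order all_algebra.
From mathcomp Require Import all_classical all_reals all_analysis.

Set Implicit Arguments.
Unset Strict Implicit.
Unset Printing Implicit Defensive.

Import Order.TTheory GRing.Theory Num.Theory.
Import numFieldNormedType.Exports.

Local Open Scope classical_set_scope.
Local Open Scope ring_scope.

Definition homeomorphic (X Y : topologicalType) : Prop :=
  exists (f : X -> Y) (g : Y -> X),
    [/\ continuous f, continuous g, cancel f g & cancel g f].

Section Convexity.
Variables (R : realType) (m : nat).
Implicit Types S P : set 'rV[R]_m.

Definition affine_hull S : set 'rV[R]_m :=
  [set x | exists (k : nat) (p : 'I_k -> 'rV[R]_m) (c : 'I_k -> R),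
    [/\ forall i, S (p i), \sum_i c i = 1 & x = \sum_i c i *: p i]].

Definition convex_hull S : set 'rV[R]_m :=
  [set x | exists (k : nat) (p : 'I_k -> 'rV[R]_m) (c : 'I_k -> R),
    [/\ forall i, S (p i), forall i, 0 <= c i,
        \sum_i c i = 1 & x = \sum_i c i *: p i]].

Definition relative_interior P : set 'rV[R]_m :=
  [set x | P x /\ \forall y \near x, affine_hull P y -> P y].

(* The empty set is a polytope. *)
Definition polytope P : Prop :=
  exists S : set 'rV[R]_m, finite_set S /\ P = convex_hull S.

End Convexity.

Definition dot (R : realType) (d : nat) (x y : 'cV[R]_d) : R :=
  \sum_k x k 0 * y k 0.

(* A family of n vectors in R^d is the d x n matrix of its columns. *)
Section Configurations.
Variables (R : realType) (d n : nat).
Implicit Types (A B C : 'M[R]_(d, n)) (Pi : {vspace 'cV[R]_d}).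

Definition nonzero_cols A : Prop := forall i, col i A != 0.

(* For nonzero vectors this is symmetric in i and j. *)
Definition nonproportional_cols A : Prop :=
  forall i j, i != j -> forall c : R, col i A != c *: col j A.

Definition vector_configuration A : Prop :=
  [/\ nonzero_cols A, nonproportional_cols A
    & (<<[seq col i A | i : 'I_n]>> = fullv)%VS].

Definition reducible_configuration A : Prop :=
  exists P P' : {vspace 'cV[R]_d},
    [/\ (P != 0)%VS, (P' != 0)%VS, (P + P')%VS = fullv, directv (P + P')
      & forall i, (col i A \in P) || (col i A \in P')].

Definition irreducible_configuration A : Prop := ~ reducible_configuration A.

Definition cols_in A Pi : {set 'I_n} := [set i | col i A \in Pi]%SET.

Definition V1 A : Prop :=
  forall x : 'cV[R]_d, \sum_i dot x (col i A) ^+ 2 = dot x x.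

Definition V2 A : Prop :=
  forall Pi, \dim Pi = 2%N -> (3 <= #|cols_in A Pi|)%N ->
    exists nu : R, forall x, x \in Pi ->
      \sum_(i in cols_in A Pi) dot x (col i A) ^+ 2 = nu * dot x x.

Definition V3 A : Prop :=
  forall Pi (i j : 'I_n), \dim Pi = 2%N -> i != j ->
    cols_in A Pi = [set i; j]%SET -> dot (col i A) (col j A) = 0.

Definition euclidean_vee_system A : Prop :=
  [/\ nonzero_cols A, nonproportional_cols A, V1 A, V2 A & V3 A].

Definition projectively_equivalent A B : Prop :=
  exists (F : 'M[R]_d) (lambda : 'I_n -> R),
    [/\ F \in unitmx, forall i, lambda i != 0
      & forall i, col i B = lambda i *: (F *m col i A)].

(* B and C lie in the same orbit of {+1, -1}^n x O(d). *)
Definition orthogonally_equivalent B C : Prop :=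
  exists (eps : 'I_n -> R) (G : 'M[R]_d),
    [/\ forall i, eps i = 1 \/ eps i = -1, G^T *m G = 1%:M
      & forall i, col i C = eps i *: (G *m col i B)].

Lemma orthogonally_equivalent_refl B : orthogonally_equivalent B B.
Proof.
exists (fun=> 1), 1%:M; split=> [i||i]; first by left.
- by rewrite trmx1 mulmx1.
- by rewrite mul1mx scale1r.
Qed.

Lemma orthogonally_equivalent_sym B C :
  orthogonally_equivalent B C -> orthogonally_equivalent C B.
Proof.
move=> [eps [G [e1 GG eC]]]; exists eps, G^T; split=> // [|i].
  by rewrite trmxK; exact: mulmx1C.
rewrite eC -scalemxAr scalerA mulmxA GG mul1mx.
by case: (e1 i) => ->; rewrite ?mulrNN mulr1 scale1r.
Qed.

Lemma orthogonally_equivalent_trans C B D :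
  orthogonally_equivalent B C -> orthogonally_equivalent C D ->
  orthogonally_equivalent B D.
Proof.
move=> [e [G [e1 GG eC]]] [f [H [f1 HH eD]]].
exists (fun i => f i * e i), (H *m G); split=> [i||i].
- by case: (e1 i) => ->; case: (f1 i) => ->; rewrite ?mulrNN ?mulr1 ?mul1r; auto.
- by rewrite trmx_mul mulmxA -(mulmxA G^T) HH mulmx1.
- by rewrite eD eC -scalemxAr scalerA mulmxA.
Qed.

Definition vee_systems_equiv_to A : set 'M[R]_(d, n) :=
  [set B | euclidean_vee_system B /\ projectively_equivalent A B].

Definition moduli_rel A : rel (set_type (vee_systems_equiv_to A)) :=
  fun x y => `[< orthogonally_equivalent (set_val x) (set_val y) >].

Lemma moduli_rel_refl A : reflexive (@moduli_rel A).
Proof. by move=> x; apply/asboolP; exact: orthogonally_equivalent_refl. Qed.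

Lemma moduli_rel_sym A : symmetric (@moduli_rel A).
Proof.
by move=> x y; apply/asboolP/asboolP; exact: orthogonally_equivalent_sym.
Qed.

Lemma moduli_rel_trans A : transitive (@moduli_rel A).
Proof.
move=> C B D /asboolP BC /asboolP CD; apply/asboolP.
exact: orthogonally_equivalent_trans BC CD.
Qed.

Canonical moduli_equiv A :=
  EquivRel (@moduli_rel A)
    (@moduli_rel_refl A) (@moduli_rel_sym A) (@moduli_rel_trans A).

Definition moduli_space A : topologicalType :=
  quotient_topology {eq_quot moduli_equiv A}%qT.

Definition base_polytope A : set 'rV[R]_n :=
  convex_hull [set \row_i (i \in I)%:R | I in
    [set I : {set 'I_n} |
      #|I| = d /\ basis_of fullv [seq col i A | i in I]]].

End Configurations.

Section Hirzebruch.
Variables (R : realType) (d n : nat) (H : 'I_n -> {vspace 'cV[R]_d}).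

(* Each subspace is listed once, so that sums over this list are sums over the
   set of codimension-2 intersections. For pairwise distinct H i, a set J of at
   least 3 indices is a set of at least 3 hyperplanes. Writing dim S + 2 = d
   avoids the truncated subtraction d - 2. *)
Definition codim2_flats : seq {vspace 'cV[R]_d} :=
  undup [seq S <- [seq (\bigcap_(i in J) H i)%VS
                     | J : {set 'I_n} in [pred J : {set 'I_n} | (3 <= #|J|)%N]]
         | (\dim S + 2 == d)%N].

Lemma mem_codim2_flats S :
  reflect (exists J : {set 'I_n},
             [/\ (3 <= #|J|)%N, S = (\bigcap_(i in J) H i)%VS
               & (\dim S + 2)%N = d])
          (S \in codim2_flats).
Proof.
rewrite mem_undup mem_filter; apply: (iffP andP).
  by move=> [/eqP dS /mapP[J]]; rewrite mem_enum inE => J3 eS; exists J; split.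
move=> [J [J3 eS dS]]; split; first exact/eqP.
by apply/mapP; exists J; rewrite ?mem_enum ?inE.
Qed.

Definition flat_weight (w : 'rV[R]_n) (S : {vspace 'cV[R]_d}) : R :=
  2^-1 * \sum_(i | (S <= H i)%VS) w 0 i.

Definition num_flats_in (i : 'I_n) : nat :=
  count (fun S => (S <= H i)%VS) codim2_flats.

Definition hirzebruch_form (w : 'rV[R]_n) : R :=
  \sum_(S <- codim2_flats) flat_weight w S ^+ 2
  - 2^-1 * \sum_i ((num_flats_in i)%:R - 1) * w 0 i ^+ 2
  - (2 * d%:R)^-1 * (\sum_i w 0 i) ^+ 2.

End Hirzebruch.

Definition polar_form (R : realType) (n : nat) (q : 'rV[R]_n -> R)
    (u v : 'rV[R]_n) : R :=
  2^-1 * (q (u + v) - q u - q v).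

Definition form_kernel (R : realType) (n : nat) (q : 'rV[R]_n -> R) :
    set 'rV[R]_n :=
  [set u | forall v, polar_form q u v = 0].

Definition orthogonal_hyperplane (R : realType) (d : nat) (a : 'cV[R]_d) :
    {vspace 'cV[R]_d} :=
  lker (linfun (mulmx a^T : 'cV[R]_d -> 'M[R]_1)).

Lemma mem_orthogonal_hyperplane (R : realType) (d : nat) (a x : 'cV[R]_d) :
  (x \in orthogonal_hyperplane a) = (dot x a == 0).
Proof.
rewrite memv_ker lfunE /=; apply/eqP/eqP => [/matrixP/(_ 0 0)|xa0].
  by rewrite !mxE => <-; apply: eq_bigr => k _; rewrite mxE mulrC.
apply/matrixP => i j; rewrite !ord1 !mxE -[RHS]xa0.
by apply: eq_bigr => k _; rewrite mxE mulrC.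
Qed.

Definition dual_arrangement (R : realType) (d n : nat) (A : 'M[R]_(d, n)) :
    'I_n -> {vspace 'cV[R]_d} :=
  fun i => orthogonal_hyperplane (col i A).

(* Main.v *)
Require Import Defs.
From mathcomp Require Import all_boot all_order all_algebra.
From mathcomp Require Import all_classical all_reals all_analysis.
From mathcomp Require Import perm ring lra.

Import Order.TTheory GRing.Theory Num.Theory.
Import numFieldNormedType.Exports.

Set Implicit Arguments.
Unset Strict Implicit.
Unset Printing Implicit Defensive.

Local Open Scope classical_set_scope.
Local Open Scope ring_scope.

(**
Condition (V1) says that [B *m B^T = 1], so a v-system is in particular a tight
frame. The homeomorphism sends the class of a v-system [B] to the vector [w] of
its squared lengths, [w i = |beta_i|^2].

Tight frames. A frame projectively equivalent to [A] has the form
[B = F *m A *m diag_mx lam]; put [lam i ^ 2 = exp (t i)]. By the Cauchy-Binet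
formula the squared minors of [B] indexed by the bases of [A] add up to 1, and
[w] is their barycentre of the indicator vectors of the bases ([leverage_sum]).
These minors are proportional to [det(A_I)^2 * exp(<t, 1_I>)], so [w] is the
value at [t] of the moment map of a finite exponential family supported by the
points spanning the base polytope ([weight_moment_map]). Such a moment map is
the gradient of a convex function: its values are strictly positive barycentres,
hence relative interior points, and it reaches each of them because a suitable
convex function is coercive and attains its minimum ([moment_map_surjective]).
Two parameters with the same image differ by a vector that has the same pairing
with every basis indicator; exchanging one element of a basis shows that such a
vector is constant when [A] is irreducible ([irreducible_separating]), and a
constant shift of [t] only rescales [F]. So [w] determines the tight frame up to
signs and rotation ([frame_determined_by_weights]). The inverse is continuous:
strict monotonicity controls [t] by [w] ([monotone_inverse_continuous]), and [F]
can be taken to be the inverse Cholesky factor of the matrix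
[A *m diag(exp t) *m A^T] ([continuous_normalizer]).

V-systems among tight frames. Split [|beta_i|^2 = \sum_j (beta_i, beta_j)^2]
according to the plane spanned by [beta_i] and [beta_j]. Up to the factor
[- |beta_i|^2], the i-th partial derivative of the Hirzebruch form at [w] is then
a sum of one term for each plane through [beta_i]. Under (V2) and (V3) all these
terms vanish. Conversely, add the equations up over [i]: a plane with two
vectors contributes twice the square of their inner product, a plane with more
vectors contributes the squared norm of the trace-free part of
[\sum beta_k beta_k^T] on that plane. A vanishing sum of squares gives (V2) and
(V3) ([vee_system_critical]). Since the Hirzebruch form depends only on which
vectors lie in common planes, it is the same for [A] and [B]
([form_kernel_vee]).

The polytope. A linear hyperplane cuts the convex hull of finitely many points
in the convex hull of those it contains and of the points where it crosses
segments between two of them ([polytope_slice]), and relative interiors commute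
with linear sections that meet them ([relative_interior_slice]). If the section
is empty, the empty polytope serves.
*)

(** * Determinants and limits of matrices *)

(** The Cauchy-Binet formula with the minors indexed by all functions instead of
subsets: each subset of size [d] is counted [d`!] times, and the functions that
are not injective contribute 0. Averaging over the permutations of the rows
replaces the product of entries given by the Leibniz formula by a second minor. *)
Lemma cauchy_binet_sum (R : comNzRingType) d n (A B : 'M[R]_(d, n)) :
  d`!%:R * \det (A *m B^T) =
  \sum_(f : {ffun 'I_d -> 'I_n}) \det (colsub f A) * \det (colsub f B).
Proof.
have detAB : \det (A *m B^T) = \sum_(f : {ffun 'I_d -> 'I_n})
    (\prod_i A i (f i)) * \det (colsub f B).
  under [RHS]eq_bigr => f _ do rewrite -det_tr big_distrr /=.
  rewrite exchange_big /=; apply: eq_bigr => s _.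
  under eq_bigr => i _ do rewrite !mxE.
  rewrite bigA_distr_bigA /= big_distrr /=; apply: eq_bigr => f _.
  rewrite big_split /= mulrCA; congr (_ * (_ * _)).
  by apply: eq_bigr => i _; rewrite !mxE.
rewrite -(card_Sn d) mulr_natl -sumr_const detAB.
transitivity (\sum_(s : 'S_d) \sum_(f : {ffun 'I_d -> 'I_n})
   (\prod_i A i (f (s i))) * ((-1) ^+ s * \det (colsub f B))).
  rewrite big_mkcond /=; apply: eq_bigr => s _.
  rewrite (reindex (fun f : {ffun 'I_d -> 'I_n} => [ffun i => f (s i)])) /=.
    apply: eq_bigr => f _; congr (_ * _).
      by apply: eq_bigr => i _; rewrite ffunE.
    have -> : colsub [ffun i => f (s i)] B = col_perm s (colsub f B).
      by apply/matrixP => i j; rewrite !mxE ffunE.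
    by rewrite col_permE det_mulmx det_perm odd_permV mulrC.
  exists (fun f : {ffun 'I_d -> 'I_n} => [ffun i => f ((s^-1)%g i)]) => f _.
    by apply/ffunP => i; rewrite !ffunE permKV.
  by apply/ffunP => i; rewrite !ffunE permK.
rewrite exchange_big /=; apply: eq_bigr => f _.
rewrite [\det (colsub f A)]/determinant big_distrl /=; apply: eq_bigr => s _.
rewrite mulrCA mulrA; congr (_ * _ * _).
by apply: eq_bigr => i _; rewrite !mxE.
Qed.

(** Both sides are the determinant of [block_mx 1 y x 1], eliminated from either
corner. *)
Lemma det_1sub_rank1 (R : comNzRingType) d (x : 'cV[R]_d) (y : 'rV[R]_d) :
  \det (1%:M - x *m y) = 1 - (y *m x) 0 0.
Proof.
pose M := block_mx (1%:M : 'M[R]_1) y x 1%:M.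
have M1 : M = block_mx 1%:M 0 x 1%:M *m block_mx 1%:M y 0 (1%:M - x *m y).
  rewrite mulmx_block !mul1mx !mulmx1 !mul0mx ?mulmx0 !addr0.
  by rewrite subrKC.
have M2 : M = block_mx (1%:M - y *m x) y 0 1%:M *m block_mx 1%:M 0 x 1%:M.
  by rewrite mulmx_block !mul1mx !mulmx1 !mul0mx ?mulmx0 !add0r subrK.
have := congr1 determinant M2; rewrite {1}M1 !det_mulmx.
rewrite !det_lblock !det_ublock !det1 !mul1r !mulr1 => ->.
by rewrite det_mx11 !mxE.
Qed.

Lemma cvg_mx (R : realType) (T : Type) m n (F : set_system T) {FF : Filter F}
    (f : T -> 'M[R]_(m, n)) (M : 'M[R]_(m, n)) :
  (forall i j, f x i j @[x --> F] --> M i j) -> f @ F --> M.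
Proof.
move=> cf; apply/filter_fromP => P nP /=.
have : \forall x \near F, forall ij : 'I_m * 'I_n, P ij.1 ij.2 (f x ij.1 ij.2).
  by apply: filter_forall => ij; apply: cf; apply: nP.
by apply: filterS => x Px i j; exact: (Px (i, j)).
Qed.

Lemma cvg_entry (R : realType) (T : Type) m n (F : set_system T)
    {FF : Filter F} (f : T -> 'M[R]_(m, n)) (M : 'M[R]_(m, n)) i j :
  f @ F --> M -> f x i j @[x --> F] --> M i j.
Proof.
move=> fM; exact: (@cvg_comp _ _ _ f (fun N : 'M[R]_(m, n) => N i j)
  F (nbhs M) (nbhs (M i j)) fM (@coord_continuous R m n i j M)).
Qed.

Lemma cvg_mxsub (R : realType) (T : Type) m n p q (F : set_system T)
    {FF : Filter F} (f : T -> 'M[R]_(m, n)) (M : 'M[R]_(m, n))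
    (g : 'I_p -> 'I_m) (h : 'I_q -> 'I_n) :
  f @ F --> M -> mxsub g h (f x) @[x --> F] --> mxsub g h M.
Proof.
move=> fM; apply: cvg_mx => i j.
under eq_fun do rewrite mxE; rewrite mxE; exact: cvg_entry.
Qed.

Lemma cvg_sumr (R : realType) (V : normedModType R) (T I : Type)
    (F : set_system T) {FF : Filter F} (r : seq I) (f : I -> T -> V)
    (a : I -> V) :
  (forall i, f i @ F --> a i) ->
  \sum_(i <- r) f i x @[x --> F] --> \sum_(i <- r) a i.
Proof.
move=> fa; apply: cvg_big => [|i _]; [exact: add_continuous | exact: fa].
Qed.

Lemma cvg_mulmx (R : realType) (T : Type) m n p (F : set_system T)
    {FF : Filter F} (f : T -> 'M[R]_(m, n)) (g : T -> 'M[R]_(n, p))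
    (M : 'M[R]_(m, n)) (N : 'M[R]_(n, p)) :
  f @ F --> M -> g @ F --> N -> f x *m g x @[x --> F] --> M *m N.
Proof.
move=> fM gN; apply: cvg_mx => i j.
under eq_fun do rewrite mxE; rewrite mxE.
apply: cvg_sumr => k.
apply: cvgM.
  exact: cvg_entry fM.
exact: cvg_entry gN.
Qed.

Lemma cvg_block (R : realType) (T : Type) m n p q (F : set_system T)
    {FF : Filter F} (f1 : T -> 'M[R]_(m, p)) (f2 : T -> 'M[R]_(m, q))
    (f3 : T -> 'M[R]_(n, p)) (f4 : T -> 'M[R]_(n, q))
    (M1 : 'M[R]_(m, p)) (M2 : 'M[R]_(m, q)) (M3 : 'M[R]_(n, p))
    (M4 : 'M[R]_(n, q)) :
  f1 @ F --> M1 -> f2 @ F --> M2 -> f3 @ F --> M3 -> f4 @ F --> M4 ->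
  block_mx (f1 x) (f2 x) (f3 x) (f4 x) @[x --> F] --> block_mx M1 M2 M3 M4.
Proof.
move=> c1 c2 c3 c4; apply: cvg_mx => i j.
by case: (split_ordP i) => i' ->; case: (split_ordP j) => j' ->;
   under eq_fun do rewrite ?(block_mxEul, block_mxEur, block_mxEdl, block_mxEdr);
   rewrite ?(block_mxEul, block_mxEur, block_mxEdl, block_mxEdr);
   apply: cvg_entry.
Qed.

Definition posdef (R : realType) d (M : 'M[R]_d) :=
  M^T = M /\ forall x : 'rV[R]_d, x != 0 -> 0 < (x *m M *m x^T) 0 0.

Lemma cholesky_step (R : realType) d (a s : R) (b : 'cV[R]_d) (C N : 'M[R]_d) :
  a != 0 -> s * s * a = 1 -> N *m (C - a^-1 *: (b *m b^T)) *m N^T = 1%:M ->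
  let G := block_mx s%:M 0 (- (a^-1 *: (N *m b))) N : 'M[R]_(1 + d) in
  G *m block_mx a%:M b^T b C *m G^T = 1%:M.
Proof.
move=> a0 ssa NSN G.
have -> : G *m block_mx a%:M b^T b C =
    block_mx (s * a)%:M (s *: b^T) 0 (N *m (C - a^-1 *: (b *m b^T))).
  rewrite /G mulmx_block !mul0mx !addr0; congr block_mx.
  - by rewrite -scalar_mxM.
  - by rewrite mul_scalar_mx.
  - by rewrite mul_mx_scalar scalerN scalerA mulfV // scale1r addNr.
  - by rewrite mulNmx -scalemxAl mulmxBr -scalemxAr mulmxA addrC.
rewrite /G tr_block_mx tr_scalar_mx trmx0 mulmx_block !mulmx0 !mul0mx addr0 add0r.
rewrite NSN [RHS]scalar_mx_block add0r; congr block_mx.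
- by rewrite -scalar_mxM mulrAC ssa.
- rewrite linearN /= linearZ /= trmx_mul mulmxN -scalemxAr -scalemxAl.
  by rewrite mul_scalar_mx scalerA mulrCA mulVf // mulr1 addNr.
Qed.

(** The inverse of the Cholesky factor of [M], built by induction on Schur
complements; this explicit recursion is what makes it continuous. *)
Lemma continuous_normalizer (R : realType) d : exists F : 'M[R]_d -> 'M[R]_d,
  forall M, posdef M -> F M *m M *m (F M)^T = 1%:M /\ F @ M --> F M.
Proof.
elim: d => [|d [F FP]].
  exists id => M _; split; last exact: cvg_id.
  by apply/matrixP => -[].
pose lead (M : 'M[R]_(1 + d)) : R := ulsubmx M 0 0.
pose schur (M : 'M[R]_(1 + d)) : 'M[R]_d :=
  drsubmx M - (lead M)^-1 *: (dlsubmx M *m (dlsubmx M)^T).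
pose G (M : 'M[R]_(1 + d)) : 'M[R]_(1 + d) :=
  block_mx (Num.sqrt (lead M))^-1%:M 0
    (- ((lead M)^-1 *: (F (schur M) *m dlsubmx M))) (F (schur M)).
suff GP (M : 'M[R]_(1 + d)) : posdef M ->
    G M *m M *m (G M)^T = 1%:M /\ G @ M --> G M by exists G; exact: GP.
move=> [Msym Mpos].
have Mblock : M = block_mx (lead M)%:M (dlsubmx M)^T (dlsubmx M) (drsubmx M).
  rewrite -[LHS]submxK [ulsubmx M]mx11_scalar; congr (block_mx _ _ _ _).
  by rewrite -{1}Msym -trmx_dlsub.
have Csym : (drsubmx M)^T = drsubmx M by rewrite trmx_drsub Msym.
set a := lead M; set b := dlsubmx M; set C := drsubmx M.
rewrite -/a -/b -/C in Mblock Csym.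
have form (u : 'rV_1) (v : 'rV_d) : (row_mx u v *m M *m (row_mx u v)^T) =
   a *: (u *m u^T) + v *m b *m u^T + (u *m b^T *m v^T + v *m C *m v^T).
  rewrite Mblock mul_row_block tr_row_mx mul_row_col mul_mx_scalar.
  by rewrite !mulmxDl -scalemxAl.
have a_gt0 : 0 < a.
  have := Mpos (row_mx 1%:M 0); rewrite form !mul0mx trmx0 mulmx0 !addr0.
  rewrite trmx1 mulmx1 !mxE mulr1n mulr1; apply.
  apply/eqP => /(congr1 lsubmx); rewrite row_mxKl linear0.
  by move=> /matrixP/(_ 0 0); rewrite !mxE => /eqP; rewrite oner_eq0.
have a_neq0 : a != 0 by rewrite gt_eqF.
have Spos : posdef (schur M).
  split=> [|x x0].
    by rewrite /schur linearB /= linearZ /= trmx_mul trmxK Csym.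
  pose y : 'M[R]_1 := x *m b.
  have yT : y^T = y by rewrite [y]mx11_scalar tr_scalar_mx.
  pose z := a^-1 *: y.
  have zT : (- z)^T = - z by rewrite !linearN /= linearZ /= yT.
  have az : a *: z = y by rewrite scalerA mulfV // scale1r.
  have := Mpos (row_mx (- z) x); rewrite form -/y zT -(mulmxA (- z)) -trmx_mul.
  rewrite -/y yT mulNmx mulmxN opprK scalemxAl az mulmxN mulNmx subrr add0r.
  rewrite /schur -/a -/b -/C mulmxBr mulmxBl -scalemxAr -!scalemxAl.
  rewrite [x *m (b *m _)]mulmxA -[x *m b *m _ *m _]mulmxA -trmx_mul -/y yT.
  rewrite addrC; apply.
  by apply: contraNneq x0 => /(congr1 rsubmx); rewrite row_mxKr linear0 => ->.
have [NSN Fcont] := FP _ Spos.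
split.
  rewrite {2}Mblock; apply: cholesky_step NSN => //.
  by rewrite -invfM -expr2 sqr_sqrtr ?mulVf // ltW.
have sub_cvg k l (g : 'I_k -> 'I_(1 + d)) (h : 'I_l -> 'I_(1 + d)) :
    mxsub g h N @[N --> M] --> mxsub g h M.
  exact: (@cvg_mxsub _ _ _ _ _ _ (nbhs M) _ id).
have ul_cvg : ulsubmx N @[N --> M] --> ulsubmx M.
  by rewrite ulsubmxEsub; under eq_fun do rewrite ulsubmxEsub; apply: sub_cvg.
have lead_cvg : lead N @[N --> M] --> a by exact: cvg_entry ul_cvg.
have leadV_cvg : (lead N)^-1 @[N --> M] --> a^-1.
  exact: (@cvgV R _ (nbhs M) _ lead a a_neq0 lead_cvg).
have b_cvg : dlsubmx N @[N --> M] --> b.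
  by rewrite /b dlsubmxEsub; under eq_fun do rewrite dlsubmxEsub; apply: sub_cvg.
have bT_cvg : (dlsubmx N)^T @[N --> M] --> b^T.
  apply: (cvg_mx (F := nbhs M)) => i j; under eq_fun do rewrite mxE; rewrite mxE.
  exact: cvg_entry b_cvg.
have C_cvg : drsubmx N @[N --> M] --> C.
  by rewrite /C drsubmxEsub; under eq_fun do rewrite drsubmxEsub; apply: sub_cvg.
have schur_cvg : schur N @[N --> M] --> schur M.
  exact: (cvgB C_cvg (cvgZ leadV_cvg (cvg_mulmx b_cvg bT_cvg))).
have FS_cvg : F (schur N) @[N --> M] --> F (schur M).
  exact: (@cvg_comp _ _ _ schur F _ (nbhs (schur M))).
apply: (cvg_block (F := nbhs M)) => //.
- apply: (cvg_mx (F := nbhs M)) => i j; under eq_fun do rewrite mxE; rewrite mxE.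
  apply: cvgMn; apply: cvgV; first by rewrite gt_eqF // sqrtr_gt0.
  apply: (@cvg_comp _ _ _ lead _ _ (nbhs a)); last exact: sqrt_continuous.
  exact: lead_cvg.
- exact: cvg_cst.
- exact: (cvgN (cvgZ leadV_cvg (cvg_mulmx FS_cvg b_cvg))).
Qed.

(** Deleting the i-th column changes [B *m B^T] from 1 to
[1 - beta *m beta^T], of determinant [1 - |beta|^2], and kills exactly the minors
using that column. *)
Lemma leverage_sum (R : realType) d n (B : 'M[R]_(d, n)) i :
  B *m B^T = 1%:M ->
  d`!%:R * dot (col i B) (col i B) =
  \sum_(f : {ffun 'I_d -> 'I_n}) \det (colsub f B) ^+ 2 * (i \in codom f)%:R.
Proof.
move=> BB.
pose C : 'M[R]_(d, n) := \matrix_(k, j) (if j == i then 0 else B k j).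
have CC : C *m C^T = 1%:M - col i B *m (col i B)^T.
  rewrite -BB; apply/matrixP => k l; rewrite !mxE big_ord1 !mxE.
  rewrite (bigD1 i) //= [in RHS](bigD1 i) //= !mxE eqxx mul0r add0r addrC addKr.
  by apply: eq_bigr => j ji; rewrite !mxE (negPf ji).
have detC (f : {ffun 'I_d -> 'I_n}) : \det (colsub f C) =
    \det (colsub f B) * (i \notin codom f)%:R.
  have [/codomP[k ik]|iNf] := boolP (i \in codom f); last first.
    rewrite mulr1; congr (\det _); apply/matrixP => k l; rewrite !mxE.
    by case: eqP => // fli; case/codomP: iNf; exists l.
  rewrite mulr0 (expand_det_col _ k) big1 // => l _.
  by rewrite !mxE -ik eqxx mul0r.
have := cauchy_binet_sum C C; rewrite CC det_1sub_rank1 mulrBr mulr1.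
have := cauchy_binet_sum B B; rewrite BB det1 mulr1 => ->.
rewrite (_ : (_ *m _) 0 0 = dot (col i B) (col i B)); last first.
  by rewrite !mxE; apply: eq_bigr => k _; rewrite !mxE.
move=> /eqP; rewrite subr_eq addrC -subr_eq eq_sym => /eqP ->.
rewrite -sumrB; apply: eq_bigr => f _; rewrite detC -expr2.
by case: (i \in codom f); rewrite /= ?mulr0 ?mulr1 ?subr0 ?subrr.
Qed.

(** * Moment maps of finite exponential families *)

Definition pairing (R : realType) n (u v : 'rV[R]_n) : R :=
  \sum_i u 0 i * v 0 i.

Section Pairing.
Variables (R : realType) (n : nat).
Implicit Types u v w : 'rV[R]_n.

Lemma pairingC u v : pairing u v = pairing v u.
Proof. by apply: eq_bigr => i _; rewrite mulrC. Qed.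

Lemma pairingDl u v w : pairing (u + v) w = pairing u w + pairing v w.
Proof. by rewrite -big_split; apply: eq_bigr => i _; rewrite mxE mulrDl. Qed.

Lemma pairingZl a u v : pairing (a *: u) v = a * pairing u v.
Proof.
by rewrite /pairing big_distrr /=; apply: eq_bigr => i _; rewrite mxE mulrA.
Qed.

Lemma pairingBl u v w : pairing (u - v) w = pairing u w - pairing v w.
Proof. by rewrite pairingDl -scaleN1r pairingZl mulN1r. Qed.

Lemma pairingDr u v w : pairing w (u + v) = pairing w u + pairing w v.
Proof. by rewrite !(pairingC w) pairingDl. Qed.

Lemma pairingZr a u v : pairing u (a *: v) = a * pairing u v.
Proof. by rewrite !(pairingC u) pairingZl. Qed.

Lemma pairing0l v : pairing 0 v = 0.
Proof. by rewrite /pairing big1 // => i _; rewrite mxE mul0r. Qed.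

Lemma pairing_suml (I : Type) (r : seq I) (P : pred I) (F : I -> 'rV[R]_n) v :
  pairing (\sum_(i <- r | P i) F i) v = \sum_(i <- r | P i) pairing (F i) v.
Proof.
apply: (big_morph (fun u => pairing u v)) => [u w|]; first exact: pairingDl.
exact: pairing0l.
Qed.

Lemma pairing_eq0 u : (forall v, pairing v u = 0) -> u = 0.
Proof.
move=> u0; apply/rowP => i; rewrite mxE -[RHS](u0 (delta_mx 0 i)).
rewrite /pairing (bigD1 i) //= mxE !eqxx mul1r big1 ?addr0 // => j ji.
by rewrite mxE (negPf ji) andbF mul0r.
Qed.

Lemma entry_le_norm m (u : 'M[R]_(m, n)) i j : `|u i j| <= `|u|.
Proof.
rewrite [leRHS]/Num.norm /= mx_normrE; apply/bigmax_geP; right.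
by exists (i, j).
Qed.

Lemma pairing_le u v : `|pairing u v| <= n%:R * (`|u| * `|v|).
Proof.
rewrite (le_trans (ler_norm_sum _ _ _)) // mulr_natl -[X in _ *+ X](card_ord n).
rewrite -sumr_const ler_sum // => i _.
by rewrite normrM ler_pM ?entry_le_norm.
Qed.

Lemma cvg_pairing (T : Type) (F : set_system T) {FF : Filter F}
    (f g : T -> 'rV[R]_n) u v :
  f @ F --> u -> g @ F --> v -> pairing (f x) (g x) @[x --> F] --> pairing u v.
Proof.
move=> fu gv; apply: cvg_sumr => k.
by apply: cvgM; apply: cvg_entry.
Qed.

End Pairing.

Section MonotoneInverse.
Variables (R : realType) (n : nat).
Implicit Types t : 'rV[R]_n.

Lemma sphere_compact t0 (e : R) : compact [set t | `|t - t0| = e].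
Proof.
apply: bounded_closed_compact.
  exists (`|e| + `|t0|); split; first exact: num_real.
  move=> x xe t /= te; apply: le_trans (ltW xe).
  by rewrite -[t](subrK t0) (le_trans (ler_normD _ _)) // te lerD2r ler_norm.
rewrite (_ : mkset _ = (fun t => `|t - t0|) @^-1` [set e]) //.
apply: preimage_closed => [t _|]; last exact: closed_eq.
exact: (cvg_norm (cvgB cvg_id (cvg_cst t0))).
Qed.

Lemma min_on_sphere t0 (e : R) (h : 'rV[R]_n -> R) :
    continuous h -> (forall t, `|t - t0| = e -> 0 < h t) ->
  exists2 m, 0 < m & forall t, `|t - t0| = e -> m <= h t.
Proof.
move=> ch hpos; have [S0|S0] := pselect ([set t | `|t - t0| = e] !=set0).
  have [|t /set_mem te tmin] := compact_EVT_min S0 (@sphere_compact t0 e) (f := h).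
    exact: continuous_subspaceT.
  by exists (h t) => [|t' t'e]; [exact: hpos | apply: tmin; rewrite inE].
by exists 1 => // t te; case: S0; exists t.
Qed.

(** On the sphere of radius [e] around [t0], the pairing of [G t - G t0] with
[t - t0] has a positive minimum. Along each ray from [t0] the component of [G]
in the direction of the ray increases, so [G t] stays away from [G t0] outside
the ball as well. *)
Lemma monotone_inverse_continuous (G : 'rV[R]_n -> 'rV[R]_n) :
    continuous G ->
    (forall t t', t != t' -> 0 < pairing (G t' - G t) (t' - t)) ->
  forall t0 e, 0 < e -> exists2 delta, 0 < delta &
    forall t, `|G t - G t0| < delta -> `|t - t0| < e.
Proof.
move=> cG Gmono t0 e e0.
pose h t := pairing (G t - G t0) (t - t0).
have [||m m0 mh] := @min_on_sphere t0 e h.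
- move=> t.
  exact: (cvg_pairing (cvgB (cG t) (cvg_cst _)) (cvgB cvg_id (cvg_cst _))).
- move=> t te; apply: Gmono; apply: contraTneq e0 => tt0.
  by rewrite -te tt0 subrr normr0 ltxx.
exists (m / (e * n.+1%:R)) => [|t]; first by rewrite divr_gt0 ?mulr_gt0.
apply: contraTT; rewrite -!leNgt => le_er.
set r := `|t - t0| in le_er; have r0 : 0 < r := lt_le_trans e0 le_er.
(* ts is the point where the ray from t0 to t crosses the sphere *)
pose s := e / r; pose ts := t0 + s *: (t - t0).
have s0 : 0 < s by rewrite divr_gt0.
have sr : s * r = e by rewrite divfK ?gt_eqF.
have tsE : ts - t0 = s *: (t - t0) by rewrite /ts addrC addKr.
have : m <= h ts by apply: mh; rewrite tsE normrZ gtr0_norm.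
rewrite /h tsE pairingZr => mts.
have ray : pairing (G ts - G t0) (t - t0) <= pairing (G t - G t0) (t - t0).
  have tts : t - ts = (1 - s) *: (t - t0).
    by rewrite scalerBl scale1r -tsE opprB addrA subrK.
  have [<-//|/Gmono] := eqVneq ts t.
  rewrite tts pairingZr => pos.
  have s1 : 0 <= 1 - s by rewrite subr_ge0 ler_pdivrMr // mul1r.
  have {}pos : 0 < pairing (G t - G ts) (t - t0) by nra.
  by apply: ltW; rewrite -subr_gt0 -pairingBl opprB addrA subrK.
have up : pairing (G t - G t0) (t - t0) <= n.+1%:R * `|G t - G t0| * r.
  rewrite (le_trans (ler_norm _)) // (le_trans (pairing_le _ _)) // -/r -mulrA.
  by apply: ler_wpM2r; [rewrite mulr_ge0 // ltW | rewrite ler_nat].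
rewrite ler_pdivrMr ?mulr_gt0 // (le_trans mts) // -sr.
rewrite (_ : _ * (_ * _) = s * (n.+1%:R * `|G t - G t0| * r)); last by ring.
by rewrite ler_pM2l // (le_trans ray).
Qed.

End MonotoneInverse.

Lemma expR_sub_ge0 (R : realType) (x y : R) : 0 <= (expR x - expR y) * (x - y).
Proof.
have [xy|/ltW yx] := lerP x y; first by rewrite mulr_le0 // subr_le0 ?ler_expR.
by rewrite mulr_ge0 // subr_ge0 ?ler_expR.
Qed.

(** The moment map sends [t] to the barycentre of the points [p f] for the Gibbs
weights [c f * exp <t, p f>], that is, to the gradient of the logarithm of the
partition function. *)
Section MomentMap.
Variables (R : realType) (n : nat) (T : finType) (c : T -> R) (p : T -> 'rV[R]_n).
Hypothesis c_ge0 : forall f, 0 <= c f.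
Implicit Types (t u v w : 'rV[R]_n).

Let gibbs t f := c f * expR (pairing t (p f)).

Definition partition_function t := \sum_f gibbs t f.

Definition moment_map t := (partition_function t)^-1 *: \sum_f gibbs t f *: p f.

Hypothesis c_gt0 : exists f, 0 < c f.

Let gibbs_ge0 t f : 0 <= gibbs t f.
Proof. by rewrite mulr_ge0 ?expR_ge0. Qed.

Lemma partition_function_gt0 t : 0 < partition_function t.
Proof.
have [f cf] := c_gt0; rewrite /partition_function (bigD1 f) //=.
by rewrite ltr_pwDl ?mulr_gt0 ?expR_gt0 // sumr_ge0.
Qed.

Lemma moment_mapP t v :
  partition_function t * pairing (moment_map t) v =
  \sum_f gibbs t f * pairing (p f) v.
Proof.
rewrite pairingZl mulrA mulfV ?gt_eqF ?partition_function_gt0 // mul1r.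
by rewrite pairing_suml; apply: eq_bigr => f _; rewrite pairingZl.
Qed.

Lemma continuous_moment_map : continuous moment_map.
Proof.
move=> t.
have gibbs_cvg f : gibbs s f @[s --> t] --> gibbs t f.
  have pf_cvg : pairing s (p f) @[s --> t] --> pairing t (p f).
    apply: (@cvg_pairing _ _ _ (nbhs t) _ id (fun=> p f)); first exact: cvg_id.
    exact: cvg_cst.
  have := @cvg_comp _ _ _ _ _ _ _ _ pf_cvg (@continuous_expR R _).
  exact: (cvgM (cvg_cst (c f))).
have Z_cvg : partition_function s @[s --> t] --> partition_function t.
  exact: (@cvg_sumr R R^o _ _ (nbhs t) _ _ (fun f s => gibbs s f)).
have sum_cvg : \sum_f gibbs s f *: p f @[s --> t] --> \sum_f gibbs t f *: p f.
  apply: (@cvg_sumr R 'rV[R]_n _ _ (nbhs t) _ _ (fun f s => gibbs s f *: p f)).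
  by move=> f; exact: (cvgZ (gibbs_cvg f) (cvg_cst _)).
apply: cvgZ sum_cvg; apply: cvgV Z_cvg.
by rewrite gt_eqF ?partition_function_gt0.
Qed.

(** Up to a ratio of partition functions, the pairing of an increment of the moment
map with the increment of its argument is a covariance: centring the pairings
[<p f, u>] at their mean for the weights at [t] turns each term into a product
of the form [(exp x - exp m) * (x - m)], which is nonnegative. *)
Lemma moment_map_gap t u : let m := pairing (moment_map t) u in
  partition_function (t + u) *
    pairing (moment_map (t + u) - moment_map t) u =
  \sum_f gibbs t f *
     ((expR (pairing (p f) u) - expR m) * (pairing (p f) u - m)).
Proof.
move=> m.
have centred : \sum_f gibbs t f * (pairing (p f) u - m) = 0.
  under eq_bigr => f _ do rewrite mulrBr.
  by rewrite sumrB -moment_mapP -mulr_suml subrr.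
have gibbsD f : gibbs (t + u) f = gibbs t f * expR (pairing (p f) u).
  by rewrite /gibbs pairingDl expRD mulrA (pairingC u).
rewrite pairingBl mulrBr moment_mapP mulr_suml -sumrB.
apply/eqP; rewrite -subr_eq0 -sumrB; apply/eqP.
transitivity (expR m * \sum_f gibbs t f * (pairing (p f) u - m)); last first.
  by rewrite centred mulr0.
by rewrite mulr_sumr; apply: eq_bigr => f _; rewrite gibbsD -/m; ring.
Qed.

Lemma moment_map_monotone t u :
  0 <= pairing (moment_map (t + u) - moment_map t) u.
Proof.
rewrite -(pmulr_rge0 _ (partition_function_gt0 (t + u))) moment_map_gap.
by apply: sumr_ge0 => f _; rewrite mulr_ge0 // expR_sub_ge0.
Qed.

Lemma moment_map_monotone_eq t u :
  pairing (moment_map (t + u) - moment_map t) u = 0 ->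
  forall f, 0 < c f -> pairing (p f) u = pairing (moment_map t) u.
Proof.
move=> u0 f cf; have /esym/eqP := moment_map_gap t u; rewrite u0 mulr0.
set m := pairing (moment_map t) u; rewrite psumr_eq0 => [|g _]; last first.
  by rewrite mulr_ge0 // expR_sub_ge0.
move=> /allP/(_ f (mem_index_enum _)) /=; rewrite mulf_eq0.
rewrite gt_eqF ?mulr_gt0 ?expR_gt0 //= mulf_eq0 !subr_eq0.
by case/orP => /eqP // /expR_inj.
Qed.

(** The moment map is invariant under translation of [t] by the vectors that
have the same pairing with all points. In the application these are only the
constant vectors. *)
Hypothesis separating : forall u m,
  (forall f, 0 < c f -> pairing (p f) u = m) -> exists a, u = const_mx a.

Let ones : 'rV[R]_n := const_mx 1.

Let ones_const a : pairing (const_mx a) ones = n%:R * a.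
Proof.
rewrite /pairing; under eq_bigr => i _ do rewrite !mxE mulr1.
by rewrite sumr_const card_ord mulr_natl.
Qed.

Let const_ones_eq0 a : pairing (const_mx a) ones = 0 -> const_mx a = 0 :> 'rV[R]_n.
Proof.
rewrite ones_const => /eqP; rewrite mulf_eq0 => /orP[|/eqP ->].
  rewrite pnatr_eq0 => /eqP n0; apply/rowP => i.
  by have := ltn_ord i; rewrite [X in (_ < X)%N]n0.
by apply/rowP => i; rewrite !mxE.
Qed.

(** The second summand breaks the invariance under constant shifts, which makes
the map strictly monotone on the whole space and avoids working in a quotient.
It vanishes where the coordinates of [t] add up to 0. *)
Definition gauged_moment_map t := moment_map t + pairing t ones *: ones.

Lemma gauged_moment_map_strict t t' : t != t' ->
  0 < pairing (gauged_moment_map t' - gauged_moment_map t) (t' - t).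
Proof.
move=> tt'; pose u := t' - t; have t'E : t' = t + u by rewrite /u addrC subrK.
have u0 : u != 0 by rewrite subr_eq0 eq_sym.
have gapE : pairing (gauged_moment_map t' - gauged_moment_map t) u =
   pairing (moment_map (t + u) - moment_map t) u + pairing u ones ^+ 2.
  rewrite t'E /gauged_moment_map opprD addrACA pairingDl -scalerBl.
  rewrite (addrC (pairing t ones)) addrK pairingDl pairingZl (pairingC ones).
  by rewrite expr2.
rewrite -/u gapE lt_def addr_ge0 ?moment_map_monotone ?sqr_ge0 // andbT.
rewrite paddr_eq0 ?moment_map_monotone ?sqr_ge0 // negb_and.
have [/eqP/moment_map_monotone_eq/separating[a uE]|//] := boolP (_ == 0).
rewrite /= sqrf_eq0; apply: contraNN u0 => /eqP.
by rewrite uE => /const_ones_eq0 ->.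
Qed.

Lemma continuous_gauged_moment_map : continuous gauged_moment_map.
Proof.
move=> t; apply: (cvgD (@continuous_moment_map t)); apply: cvgZ (cvg_cst _).
apply: (@cvg_pairing _ _ _ (nbhs t) _ id (fun=> ones)); first exact: cvg_id.
exact: cvg_cst.
Qed.

(** The last hypothesis says that [w] does not lie in a proper face of the
convex hull of the points; it is how relative interior points enter the
existence proof. *)
Variable w : 'rV[R]_n.
Hypothesis w_level : forall f, 0 < c f -> pairing (p f) ones = pairing w ones.
Hypothesis w_interior : forall u,
  (forall f, 0 < c f -> pairing (p f - w) u <= 0) ->
  forall f, 0 < c f -> pairing (p f - w) u = 0.

Let pos (y : R) : R := (y + `|y|) / 2.

Let pos_ge0 y : 0 <= pos y.
Proof. by rewrite /pos; have [] := ger0P y; lra. Qed.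

Let pos_le_expR y : pos y <= expR y.
Proof.
have := expR_ge1Dx y; have := expR_ge0 y.
by rewrite /pos; have [] := ger0P y; lra.
Qed.

(** A positively homogeneous lower bound for [energy] below, up to a constant; the
hypotheses on [w] make it positive off the origin, which gives coercivity. *)
Let height u := \sum_f c f * pos (pairing (p f - w) u) + `|pairing u ones|.

Let height_gt0 u : u != 0 -> 0 < height u.
Proof.
move=> u0; have term_ge0 f : 0 <= c f * pos (pairing (p f - w) u).
  by rewrite mulr_ge0.
rewrite lt_def addr_ge0 ?sumr_ge0 // andbT paddr_eq0 ?sumr_ge0 // negb_and.
have [|//] := boolP (_ == 0); rewrite psumr_eq0 // => /allP all0.
have interior_u f : 0 < c f -> pairing (p f - w) u <= 0.
  move=> cf; have := all0 f (mem_index_enum _).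
  rewrite /= mulf_eq0 gt_eqF //= /pos => /eqP.
  by have [] := ger0P (pairing (p f - w) u); lra.
have const_u f : 0 < c f -> pairing (p f) u = pairing w u.
  by move=> cf; apply/eqP; rewrite -subr_eq0 -pairingBl w_interior.
have [a uE] := separating const_u.
by rewrite normr_eq0; apply: contraNN u0 => /eqP; rewrite uE => /const_ones_eq0 ->.
Qed.

Let continuous_pairing v : continuous (fun s : 'rV[R]_n => pairing s v).
Proof.
move=> t; apply: (@cvg_pairing _ _ _ (nbhs t) _ id (fun=> v)).
  exact: cvg_id.
exact: cvg_cst.
Qed.

Let continuous_height : continuous height.
Proof.
move=> t.
have term_cvg f : c f * pos (pairing (p f - w) s) @[s --> t] -->
    c f * pos (pairing (p f - w) t).
  have pf_cvg : pairing (p f - w) s @[s --> t] --> pairing (p f - w) t.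
    by rewrite pairingC; under eq_fun do rewrite pairingC; exact: continuous_pairing.
  exact: (cvgM (cvg_cst _) (cvgM (cvgD pf_cvg (cvg_norm pf_cvg)) (cvg_cst _))).
apply: (cvgD _ (cvg_norm (@continuous_pairing ones t))).
exact: (@cvg_sumr R R^o _ _ (nbhs t) _ _
  (fun f s => c f * pos (pairing (p f - w) s))).
Qed.

Let heightZ (a : R) t : 0 <= a -> height (a *: t) = a * height t.
Proof.
move=> a0; rewrite /height pairingZl normrM ger0_norm // mulrDr; congr (_ + _).
rewrite mulr_sumr; apply: eq_bigr => f _.
by rewrite pairingZr /pos normrM ger0_norm //; ring.
Qed.

Let height_coercive : exists2 m, 0 < m & forall t, m * `|t| <= height t.
Proof.
have [|t|m m0 mh] := @min_on_sphere R n 0 1 height; first exact: continuous_height.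
  rewrite subr0 => t1; apply: height_gt0; apply: contra_eq_neq t1 => ->.
  by rewrite normr0 eq_sym oner_eq0.
exists m => // t; have [->|t0] := eqVneq t 0.
  have := @heightZ 0 0 (lexx 0).
  by rewrite scaler0 mul0r => ->; rewrite normr0 mulr0.
have t_gt0 : 0 < `|t| by rewrite normr_gt0.
have := mh (`|t|^-1 *: t); rewrite subr0 normrZ normfV normr_id mulVf ?gt_eqF //.
move=> /(_ erefl); rewrite heightZ ?invr_ge0 //.
by rewrite mulrC ler_pdivlMr.
Qed.

(** The first summand is the partition function of the points translated by
[- w], whose gradient vanishes where the moment map takes the value [w]; the
square makes the function coercive along constant vectors too. *)
Let energy t := \sum_f c f * expR (pairing (p f - w) t) + pairing t ones ^+ 2.

Let energy_ge t : height t - 1 <= energy t.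
Proof.
have sq (x : R) : `|x| - 1 <= x ^+ 2.
  by rewrite -real_normK ?num_real //; have := sqr_ge0 (`|x| - 2^-1); lra.
rewrite /height /energy -addrA lerD // ler_sum // => f _.
by rewrite ler_wpM2l.
Qed.

Let continuous_energy : continuous energy.
Proof.
move=> t.
have term_cvg f : c f * expR (pairing (p f - w) s) @[s --> t] -->
    c f * expR (pairing (p f - w) t).
  have pf_cvg : pairing (p f - w) s @[s --> t] --> pairing (p f - w) t.
    by rewrite pairingC; under eq_fun do rewrite pairingC; exact: continuous_pairing.
  have := @cvg_comp _ _ _ _ _ _ _ _ pf_cvg (@continuous_expR R _).
  exact: (cvgM (cvg_cst (c f))).
have ones_cvg := @continuous_pairing ones t.
apply: (cvgD _ (cvgM ones_cvg ones_cvg)).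
exact: (@cvg_sumr R R^o _ _ (nbhs t) _ _
  (fun f s => c f * expR (pairing (p f - w) s))).
Qed.

Let energy_minimum : exists t, forall s, energy t <= energy s.
Proof.
have [m m0 mh] := height_coercive.
pose r := (energy 0 + 1) / m.
have energy0_ge0 : 0 <= energy 0.
  by rewrite addr_ge0 ?sqr_ge0 ?sumr_ge0 // => f _; rewrite mulr_ge0 ?expR_ge0.
have r0 : 0 <= r by apply: divr_ge0; [rewrite addr_ge0 | exact: ltW].
have ball_compact : compact [set t : 'rV[R]_n | `|t| <= r].
  apply: bounded_closed_compact.
    exists r; split; first exact: num_real.
    by move=> x rx t /= tr; rewrite (le_trans tr) // ltW.
  rewrite (_ : mkset _ = (fun t => `|t|) @^-1` [set x | x <= r]) //.
  by apply: preimage_closed => [t _|]; [exact: norm_continuous | exact: closed_le].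
have [||t _ tmin] := compact_EVT_min _ ball_compact (f := energy).
- by exists 0; rewrite /= normr0.
- exact: continuous_subspaceT.
exists t => s; have [sr|rs] := lerP `|s| r; first by apply: tmin; rewrite inE.
apply: (le_trans (tmin 0 _)); first by rewrite inE /= normr0.
apply: le_trans (energy_ge s); rewrite lerBrDr (le_trans _ (mh s)) //.
by rewrite mulrC -ler_pdivrMr // ltW.
Qed.

Let energy_derivative t v (s0 : R) :
  is_derive s0 (1 : R) (fun s : R => energy (t + s *: v))
    (\sum_f c f * expR (pairing (p f - w) (t + s0 *: v)) * pairing (p f - w) v +
     2 * pairing (t + s0 *: v) ones * pairing v ones).
Proof.
have affine a b : is_derive s0 (1 : R) (fun s : R => a + s * b) b.
  apply: is_derive_eq.
  by rewrite /GRing.scale /=; ring.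
have -> : (fun s : R => energy (t + s *: v)) =
    (\sum_(i < #|T|) (fun s : R => c (enum_val i) *
       expR (pairing (p (enum_val i) - w) t +
             s * pairing (p (enum_val i) - w) v))) +
    (fun s : R => (pairing t ones + s * pairing v ones) ^+ 2).
  apply/funext => s; rewrite /energy fctE fct_sumE pairingDl pairingZl.
  congr (_ + _); rewrite (reindex _ (onW_bij _ (@enum_val_bij T))).
  by apply: eq_bigr => i _; rewrite pairingDr pairingZr.
rewrite [X in _ (X + _)](reindex _ (onW_bij _ (@enum_val_bij T))) /=.
apply: is_deriveD.
  apply: is_derive_sum => i; rewrite pairingDr pairingZr.
  set a := pairing _ t; set b := pairing _ v.
  have compD := @is_derive1_comp _ expR _ s0 _ _ (is_derive_expR _) (affine a b).
  rewrite -mulrA; exact: (is_deriveZ (c (enum_val i)) compD).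
have aff := affine (pairing t ones) (pairing v ones).
rewrite pairingDl pairingZl.
by apply: is_derive_eq; rewrite /GRing.scale /=; ring.
Qed.

Lemma moment_map_surjective :
  exists t, moment_map t = w /\ pairing t ones = 0.
Proof.
have [t tmin] := energy_minimum.
pose a f := c f * expR (pairing (p f - w) t).
have critical v :
    \sum_f a f * pairing (p f - w) v + 2 * pairing t ones * pairing v ones = 0.
  have := energy_derivative t v 0; rewrite scale0r addr0 -/(a _) => -[_ <-].
  have := @derive1_at_min R (fun s => energy (t + s *: v)) (-1) 1 0.
  case=> [|s _||s _|_ //]; first by lra.
  - by have [] := energy_derivative t v s.
  - by rewrite in_itv /= ltrN10 ltr01.
  - by rewrite scale0r addr0.
(* differentiating along ones, only the square contributes, since all the points
lie in the same level set of the pairing with ones as w *)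
have ones0 : pairing t ones = 0.
  have := critical ones; rewrite big1 ?add0r => [|f _]; last first.
    have [c0|cf] := eqVneq (c f) 0; first by rewrite /a c0 !mul0r.
    by rewrite pairingBl w_level ?subrr ?mulr0 // lt_def cf c_ge0.
  rewrite ones_const mulr1 => /eqP; rewrite mulf_eq0 => /orP[|].
    by rewrite mulf_eq0 pnatr_eq0 => /eqP.
  rewrite pnatr_eq0 => /eqP n0; rewrite /pairing big1 // => i _.
  by have := ltn_ord i; rewrite [X in (_ < X)%N]n0.
exists t; split=> //.
have sum0 : \sum_f gibbs t f *: (p f - w) = 0.
  have gibbsE f : gibbs t f = expR (pairing w t) * a f.
    rewrite /gibbs /a mulrCA -expRD pairingBl addrC subrK.
    by rewrite (pairingC t).
  apply: pairing_eq0 => v; rewrite pairingC pairing_suml.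
  have := critical v; rewrite ones0 mulr0 mul0r addr0 => sum0.
  transitivity (expR (pairing w t) * \sum_f a f * pairing (p f - w) v).
    by rewrite mulr_sumr; apply: eq_bigr => f _; rewrite pairingZl gibbsE mulrA.
  by rewrite sum0 mulr0.
have Zw : \sum_f gibbs t f *: p f = partition_function t *: w.
  apply/eqP; rewrite -subr_eq0 scaler_suml -sumrB; apply/eqP.
  by rewrite (eq_bigr _ (fun f _ => esym (scalerBr _ _ _))).
by rewrite /moment_map Zw scalerA mulVf ?scale1r // gt_eqF ?partition_function_gt0.
Qed.

End MomentMap.

(** * Convex hulls, relative interiors and slices of polytopes *)

Section Hulls.
Variables (R : realType) (m : nat).
Implicit Types (S P : set 'rV[R]_m) (x y z : 'rV[R]_m).

Lemma affine_hull_fin (I : finType) S (p : I -> 'rV[R]_m) (c : I -> R) :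
  (forall i, S (p i)) -> \sum_i c i = 1 -> affine_hull S (\sum_i c i *: p i).
Proof.
move=> Sp c1; exists #|I|, (p \o enum_val), (c \o enum_val); split=> [i||//].
- exact: Sp.
- by rewrite -c1 [RHS](reindex _ (onW_bij _ (@enum_val_bij I))).
- by rewrite (reindex _ (onW_bij _ (@enum_val_bij I))).
Qed.

Lemma convex_hull_fin (I : finType) S (p : I -> 'rV[R]_m) (c : I -> R) :
  (forall i, S (p i)) -> (forall i, 0 <= c i) -> \sum_i c i = 1 ->
  convex_hull S (\sum_i c i *: p i).
Proof.
move=> Sp c0 c1; exists #|I|, (p \o enum_val), (c \o enum_val); split=> [i|i||].
- exact: Sp.
- exact: c0.
- by rewrite -c1 [RHS](reindex _ (onW_bij _ (@enum_val_bij I))).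
- by rewrite (reindex _ (onW_bij _ (@enum_val_bij I))).
Qed.

Lemma affine_hull_comb S x y (a b : R) : a + b = 1 ->
  affine_hull S x -> affine_hull S y -> affine_hull S (a *: x + b *: y).
Proof.
move=> ab [k [p [c [Sp c1 ->]]]] [l [q [e [Sq e1 ->]]]].
have := @affine_hull_fin ('I_k + 'I_l)%type S
  (fun i => match i with inl j => p j | inr j => q j end)
  (fun i => match i with inl j => a * c j | inr j => b * e j end).
rewrite !big_sumType /= !scaler_sumr -!mulr_sumr c1 e1 !mulr1.
rewrite (eq_bigr _ (fun i _ => scalerA a (c i) (p i))).
rewrite (eq_bigr _ (fun i _ => scalerA b (e i) (q i))).
by apply=> // -[].
Qed.

Lemma convex_hull_comb S x y (a b : R) : 0 <= a -> 0 <= b -> a + b = 1 ->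
  convex_hull S x -> convex_hull S y -> convex_hull S (a *: x + b *: y).
Proof.
move=> a0 b0 ab [k [p [c [Sp c0 c1 ->]]]] [l [q [e [Sq e0 e1 ->]]]].
have := @convex_hull_fin ('I_k + 'I_l)%type S
  (fun i => match i with inl j => p j | inr j => q j end)
  (fun i => match i with inl j => a * c j | inr j => b * e j end).
rewrite !big_sumType /= !scaler_sumr -!mulr_sumr c1 e1 !mulr1.
rewrite (eq_bigr _ (fun i _ => scalerA a (c i) (p i))).
rewrite (eq_bigr _ (fun i _ => scalerA b (e i) (q i))).
by apply=> // -[] i //; rewrite mulr_ge0.
Qed.

Lemma sub_affine_hull S : S `<=` affine_hull S.
Proof.
move=> x Sx; exists 1%N, (fun=> x), (fun=> 1).
by rewrite !big_ord1 scale1r.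
Qed.

Lemma sub_convex_hull S : S `<=` convex_hull S.
Proof.
move=> x Sx; exists 1%N, (fun=> x), (fun=> 1).
by rewrite !big_ord1 scale1r; split.
Qed.

Lemma sub_affine_hullP S P : S `<=` P -> affine_hull S `<=` affine_hull P.
Proof.
move=> SP x [k [p [c [Sp c1 xE]]]]; exists k, p, c; split=> // i; exact/SP/Sp.
Qed.

Lemma affine_hull_pairing S (l : 'rV[R]_m) (a : R) :
  (forall x, S x -> pairing x l = a) -> forall x, affine_hull S x -> pairing x l = a.
Proof.
move=> Sl x [k [p [c [Sp c1 ->]]]]; rewrite pairing_suml.
under eq_bigr => i _ do rewrite pairingZl (Sl _ (Sp i)).
by rewrite -mulr_suml c1 mul1r.
Qed.

Lemma convex_hull_pairing_le S (l : 'rV[R]_m) (a : R) :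
  (forall x, S x -> pairing x l <= a) ->
  forall x, convex_hull S x -> pairing x l <= a.
Proof.
move=> Sl x [k [p [c [Sp c0 c1 ->]]]]; rewrite pairing_suml.
rewrite -[a]mul1r -c1 mulr_suml ler_sum // => i _.
by rewrite pairingZl ler_wpM2l ?Sl.
Qed.

Lemma relative_interior_extend P x y : relative_interior P x ->
  affine_hull P y -> exists2 e : R, 0 < e & P (x + e *: (x - y)).
Proof.
move=> [Px nearP] Py.
have line_cvg : x + e *: (x - y) @[e --> (0 : R)] --> x.
  have : x + e *: (x - y) @[e --> (0 : R)] --> x + 0 *: (x - y).
    exact: (cvgD (cvg_cst _) (cvgZ cvg_id (cvg_cst _))).
  by rewrite scale0r addr0.
have /nbhs_ballP[r /= r0 rP] := line_cvg _ nearP.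
have r2 : 0 < r / 2 by rewrite divr_gt0.
exists (r / 2) => //; apply: (rP (r / 2)).
  by rewrite -ball_normE /= sub0r normrN gtr0_norm // gtr_pMr // invf_lt1 ?ltr1n.
rewrite (_ : _ + _ = (1 + r / 2) *: x + (- (r / 2)) *: y); last first.
  by rewrite scalerDl scale1r scalerBr scaleNr addrA.
by apply: affine_hull_comb => //; [rewrite addrK | exact: sub_affine_hull].
Qed.

(** A linear form maximal at a relative interior point is constant: otherwise
it would increase on the prolongation of a segment ending at that point. *)
Lemma relative_interior_supporting S w (u : 'rV[R]_m) :
  relative_interior (convex_hull S) w ->
  (forall p, S p -> pairing (p - w) u <= 0) ->
  forall p, S p -> pairing (p - w) u = 0.
Proof.
move=> wS Su p Sp; apply/eqP; rewrite eq_le Su //=.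
have [e e0 /convex_hull_pairing_le] := relative_interior_extend wS
  (sub_affine_hull (sub_convex_hull Sp)).
move=> /(_ u (pairing w u)) le_w; rewrite pairingBl subr_ge0.
suff : pairing (w + e *: (w - p)) u <= pairing w u.
  rewrite pairingDl pairingZl pairingBl gerDl pmulr_rle0 // subr_le0.
  by [].
by apply: le_w => x Sx; rewrite -subr_le0 -pairingBl Su.
Qed.

End Hulls.

Section FiniteHulls.
Variables (R : realType) (m : nat) (T : finType) (A : pred T) (p : T -> 'rV[R]_m).

Let points := [set p f | f in [set f | A f]].

Lemma finite_convex_hullP x : convex_hull points x <->
  exists a : T -> R, [/\ forall f, A f -> 0 <= a f, \sum_(f | A f) a f = 1 &
    x = \sum_(f | A f) a f *: p f].
Proof.
split=> [[k [q [c [Sq c0 c1 ->]]]]|[a [a0 a1 ->]]].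
  have /choice[g gP] i : exists f, A f /\ p f = q i by have [f] := Sq i; exists f.
  exists (fun f => \sum_(i | g i == f) c i); split.
  - by move=> f _; exact: sumr_ge0.
  - rewrite -c1 [RHS](partition_big g A) //= => i _; exact: (gP i).1.
  - rewrite (partition_big g A) /= => [|i _]; last exact: (gP i).1.
    apply: eq_bigr => f _; rewrite scaler_suml; apply: eq_bigr => i /eqP <-.
    by rewrite (gP i).2.
exists #|A|, (fun i => p (enum_val i)), (fun i => a (enum_val i)); split=> //.
- by move=> i; exists (enum_val i) => //; exact: (enum_valP i).
- by move=> i; apply: a0; exact: (enum_valP i).
- by rewrite -a1 -(big_enum_val (A := A) a).
- by rewrite -(big_enum_val (A := A) (fun f => a f *: p f)).
Qed.

Lemma finite_affine_hull x : affine_hull (convex_hull points) x ->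
  exists2 b : T -> R, \sum_(f | A f) b f = 1 & x = \sum_(f | A f) b f *: p f.
Proof.
move=> [k [q [c [Sq c1 ->]]]].
have /choice[a aP] i := (finite_convex_hullP (q i)).1 (Sq i).
exists (fun f => \sum_i c i * a i f).
  rewrite exchange_big -c1; apply: eq_bigr => i _.
  by rewrite -mulr_sumr; have [_ -> _] := aP i; rewrite mulr1.
under [RHS]eq_bigr do rewrite scaler_suml.
rewrite exchange_big; apply: eq_bigr => i _; have [_ _ ->] := aP i.
by rewrite scaler_sumr; apply: eq_bigr => f _; rewrite scalerA.
Qed.

Lemma finite_convex_hull_idem :
  convex_hull (convex_hull points) `<=` convex_hull points.
Proof.
move=> x [k [q [c [Sq c0 c1 ->]]]].
have /choice[a aP] i := (finite_convex_hullP (q i)).1 (Sq i).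
apply/finite_convex_hullP; exists (fun f => \sum_i c i * a i f); split.
- move=> f Af; apply: sumr_ge0 => i _; have [/(_ f Af) a0 _ _] := aP i.
  by rewrite mulr_ge0.
- rewrite exchange_big -c1; apply: eq_bigr => i _.
  by rewrite -mulr_sumr; have [_ -> _] := aP i; rewrite mulr1.
under [RHS]eq_bigr do rewrite scaler_suml.
rewrite exchange_big; apply: eq_bigr => i _; have [_ _ ->] := aP i.
by rewrite scaler_sumr; apply: eq_bigr => f _; rewrite scalerA.
Qed.

(** A point near [x] in the affine hull differs from [x] by a combination of the
points whose coefficients add up to 0. These coefficients can be chosen linearly
in the difference, so they tend to 0 and do not spoil positivity. *)
Lemma positive_combination_relative_interior (a : T -> R) :
  (forall f, A f -> 0 < a f) -> \sum_(f | A f) a f = 1 ->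
  relative_interior (convex_hull points) (\sum_(f | A f) a f *: p f).
Proof.
move=> a0 a1; set x := \sum_(f | A f) _.
have hullx : convex_hull points x.
  apply/finite_convex_hullP; exists a; split=> // f Af; exact: ltW (a0 f Af).
split=> //.
(* the extra column of ones records the sum of the coefficients; the
pseudo-inverse of M is the linear choice of coefficients *)
pose M : 'M[R]_(#|T|, m + 1) := \matrix_i
  (if A (enum_val i) then row_mx (p (enum_val i)) 1%:M else 0).
pose coef (y : 'rV[R]_m) f : R := ((y - x) *m usubmx (pinvmx M)) 0 (enum_rank f).
have coef_cvg f : coef y f @[y --> x] --> 0.
  have : coef y f @[y --> x] --> coef x f.
    exact: cvg_entry (cvg_mulmx (cvgB cvg_id (cvg_cst _)) (cvg_cst _)).
  by rewrite {2}/coef subrr mul0mx mxE.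
have : \forall y \near x, forall f, A f -> 0 < a f + coef y f.
  apply: (@filter_forall _ _ (fun f y => A f -> 0 < a f + coef y f) (nbhs x)) => f.
  have [Af|nAf] := boolP (A f); last exact: nearW.
  have : a f + coef y f @[y --> x] --> a f + 0 by exact: (cvgD (cvg_cst _) (coef_cvg f)).
  rewrite addr0 => /cvgr_gt/(_ 0 (a0 f Af)); apply: filterS => y ? _; exact.
apply: filterS => y ypos affy.
have [b b1 yE] : exists2 b : T -> R, \sum_(f | A f) b f = 1 &
    y = \sum_(f | A f) b f *: p f by exact: finite_affine_hull.
have rowM f : A f -> row (enum_rank f) M = row_mx (p f) 1%:M.
  by move=> Af; rewrite rowK enum_rankK Af.
have yxE : row_mx (y - x) 0 = \sum_(f | A f) (b f - a f) *: row_mx (p f) 1%:M.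
  under eq_bigr do rewrite scale_row_mx scale_scalar_mx mulr1.
  rewrite -[RHS]hsubmxK; congr row_mx; rewrite [RHS]linear_sum /=.
    rewrite {1}yE -sumrB; apply: eq_bigr => f _.
    by rewrite row_mxKl scalerBl.
  under [RHS]eq_bigr do rewrite row_mxKr.
  by rewrite -raddf_sum /= sumrB b1 a1 subrr raddf0.
have yxM : (row_mx (y - x) (0 : 'M[R]_(1, 1)) <= M)%MS.
  rewrite yxE summx_sub // => f Af; rewrite scalemx_sub // -rowM //.
  exact: row_sub.
have := mulmxKpV yxM; rewrite -{1}[pinvmx M]vsubmxK mul_row_col mul0mx addr0.
rewrite mulmx_sum_row (reindex _ (onW_bij _ (@enum_rank_bij T))) /=.
rewrite (bigID A) /= [X in _ + X]big1 ?addr0 => [|f nAf]; last first.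
  by rewrite rowK enum_rankK (negPf nAf) scaler0.
under eq_bigr => f Af do rewrite -/(coef y f) rowM // scale_row_mx scale_scalar_mx mulr1.
move=> coefE.
have coef0 : \sum_(f | A f) coef y f = 0.
  have := congr1 rsubmx coefE; rewrite row_mxKr linear_sum /=.
  under eq_bigr do rewrite row_mxKr.
  by rewrite -raddf_sum => /matrixP/(_ 0 0); rewrite !mxE mulr1n.
have coefyx : \sum_(f | A f) coef y f *: p f = y - x.
  have := congr1 lsubmx coefE; rewrite row_mxKl linear_sum /=.
  by under eq_bigr do rewrite row_mxKl.
apply/finite_convex_hullP; exists (fun f => a f + coef y f).
split=> [f /ypos /ltW //||].
- by rewrite big_split /= a1 coef0 addr0.
- under eq_bigr do rewrite scalerDl.
  by rewrite big_split /= coefyx -/x addrC subrK.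
Qed.

End FiniteHulls.

Lemma polytope_fin (R : realType) m (T : finType) (A : pred T) (p : T -> 'rV[R]_m) :
  polytope (convex_hull [set p f | f in [set f | A f]]).
Proof.
exists [set p f | f in [set f | A f]]; split=> //.
by apply: finite_image; exact: finite_finset.
Qed.

(** Each mass [c i] on the positive side of a hyperplane is spread over the points
of the negative side in proportion to their moments [c j * - v j], and
conversely; the pair [(i, j)] then carries a multiple of
[v i *: g j - v j *: g i], which is proportional to the crossing point of its
segment. The identity holds in every module, in particular for
the points and for the total mass. *)
Lemma crossing_sum (R : realType) (I : finType) (c v : I -> R) :
  (forall i, 0 <= c i) -> \sum_i c i * v i = 0 ->
  forall (V : lmodType R) (g : I -> V),
  \sum_i c i *: g i = \sum_(i | v i == 0) c i *: g i +
    \sum_(i | 0 < v i) \sum_(j | v j < 0)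
      (c i * c j / (\sum_(l | 0 < v l) c l * v l)) *: (v i *: g j - v j *: g i).
Proof.
move=> c0 cv V g; set T := \sum_(l | 0 < v l) c l * v l.
have split3 (W : nmodType) (h : I -> W) : \sum_i h i = \sum_(i | v i == 0) h i +
    (\sum_(i | 0 < v i) h i + \sum_(i | v i < 0) h i).
  rewrite (bigID (fun i => v i == 0)) /=; congr (_ + _).
  rewrite (bigID (fun i => 0 < v i)) /=; congr (_ + _); apply: eq_bigl => i;
    by case: (ltgtP (v i) 0).
have negT : \sum_(j | v j < 0) c j * - v j = T.
  have := cv; rewrite split3 big1 ?add0r => [|i /eqP ->]; last exact: mulr0.
  move=> /eqP; rewrite addr_eq0 -/T => /eqP ->; rewrite -sumrN.
  by apply: eq_bigr => i _; rewrite mulrN.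
(* if T = 0 then no mass lies off the hyperplane, and the division by T is
harmless *)
have TK i : v i != 0 -> T * (c i / T) = c i.
  move=> vi; have [T0|T0] := eqVneq T 0; last by rewrite mulrC divfK.
  have pos_ge0 j : 0 < v j -> 0 <= c j * v j by move=> /ltW; exact: mulr_ge0.
  have neg_ge0 j : v j < 0 -> 0 <= c j * - v j.
    by move=> /ltW; rewrite -oppr_ge0; exact: mulr_ge0.
  suff c_i0 : c i = 0 by rewrite c_i0 mul0r mulr0.
  have [vneg|vpos|/eqP] := ltgtP (v i) 0; last by rewrite (negPf vi).
    move: negT; rewrite T0 => /(psumr_eq0P neg_ge0)/(_ i vneg)/eqP.
    by rewrite mulf_eq0 oppr_eq0 (negPf vi) orbF => /eqP.
  move: T0 => /(psumr_eq0P pos_ge0)/(_ i vpos)/eqP.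
  by rewrite mulf_eq0 (negPf vi) orbF => /eqP.
rewrite split3; congr (_ + _).
transitivity (\sum_(i | 0 < v i) \sum_(j | v j < 0) (c j * - v j * (c i / T)) *: g i
  + \sum_(j | v j < 0) \sum_(i | 0 < v i) (c i * v i * (c j / T)) *: g j).
  congr (_ + _); apply: eq_bigr => i vi.
    by rewrite -scaler_suml -mulr_suml negT TK // gt_eqF.
  by rewrite -scaler_suml -mulr_suml TK // lt_eqF.
rewrite [X in _ + X]exchange_big -big_split; apply: eq_bigr => i _.
rewrite -big_split; apply: eq_bigr => j _ /=.
rewrite scalerBr !scalerA -scaleNr addrC; congr (_ *: _ + _ *: _); ring.
Qed.

(** The section is the hull of the points on the hyperplane ([inl i]) and of
the crossing points of segments between points on opposite sides
([inr (i, j)]). *)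
Lemma polytope_slice (R : realType) m (P : set 'rV[R]_m) (l : 'rV[R]_m) :
  polytope P -> polytope (P `&` [set x | pairing x l = 0]).
Proof.
move=> [S [/finite_seqP[s ->] ->]].
pose k := size s; pose p (i : 'I_k) : 'rV[R]_m := nth 0 s i.
have -> : [set` s] = [set p f | f in [set f | xpredT f]].
  apply/seteqP; split=> x /=.
    by move=> /(nthP 0)[i ik <-]; exists (Ordinal ik).
  by move=> [i _ <-]; exact: mem_nth.
pose v i := pairing (p i) l.
pose A (f : 'I_k + 'I_k * 'I_k) := match f with
  | inl i => v i == 0 | inr ij => (0 < v ij.1) && (v ij.2 < 0) end.
pose q (f : 'I_k + 'I_k * 'I_k) : 'rV[R]_m := match f with
  | inl i => p i
  | inr ij => (v ij.1 - v ij.2)^-1 *: (v ij.1 *: p ij.2 - v ij.2 *: p ij.1) end.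
rewrite (_ : _ `&` _ = convex_hull [set q f | f in [set f | A f]]); last first.
  apply/seteqP; split=> x.
    move=> [/finite_convex_hullP[c [c0 c1 xE]]] /=.
    rewrite xE pairing_suml; under eq_bigr do rewrite pairingZl; move=> cv.
    have c_ge0 i : 0 <= c i by exact: c0.
    pose a (f : 'I_k + 'I_k * 'I_k) := match f with
      | inl i => c i
      | inr ij => c ij.1 * c ij.2 / (\sum_(i | 0 < v i) c i * v i) *
                    (v ij.1 - v ij.2) end.
    have sum_split := @crossing_sum R _ c v c_ge0 cv.
    apply/finite_convex_hullP; exists a; split.
    - move=> [i|[i j]] //= /andP[vi vj].
      apply: mulr_ge0; last by rewrite subr_ge0 ltW // (lt_trans vj).
      rewrite mulr_ge0 ?mulr_ge0 // invr_ge0 sumr_ge0 // => i' vi'.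
      by rewrite mulr_ge0 // ltW.
    - rewrite -c1 big_sumType /=; have := sum_split R^o (fun=> 1).
      rewrite (eq_bigr c) => [->|i _]; last exact: mulr1.
      rewrite pair_big_dep /=; congr (_ + _); apply: eq_bigr => // i _.
        exact: esym (mulr1 _).
      by congr (_ * _); rewrite /GRing.scale /= !mulr1.
    - rewrite big_sumType /= sum_split pair_big_dep /=; congr (_ + _).
      apply: eq_bigr => -[i j] /= /andP[vi vj]; rewrite scalerA mulfK //.
      by rewrite subr_eq0 gt_eqF // (lt_trans vj).
  move=> [n [r [c [Sr c0 c1 ->]]]]; split; last first.
    rewrite /= pairing_suml big1 // => i _; rewrite pairingZl.
    have [[j|[j j']]] := Sr i => /= [/eqP vj <-|/andP[vj vj'] <-].
      by rewrite -/(v j) vj mulr0.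
    by rewrite pairingZl pairingBl !pairingZl -/(v j) -/(v j') mulrC; ring.
  apply: finite_convex_hull_idem; exists n, r, c; split=> // i.
  have [[j|[j j']]] := Sr i => /= [_ <-|/andP[vj vj'] <-].
    by apply: sub_convex_hull; exists j.
  have vjj' : 0 < v j - v j' by rewrite subr_gt0 (lt_trans vj').
  rewrite scalerBr !scalerA -scaleNr; apply: convex_hull_comb.
  - by rewrite mulr_ge0 ?invr_ge0 ?ltW.
  - by rewrite -mulrN mulr_ge0 ?invr_ge0 ?oppr_ge0 ?ltW.
  - by rewrite -mulrBr mulVf // gt_eqF.
  - by apply: sub_convex_hull; exists j'.
  - by apply: sub_convex_hull; exists j.
exact: polytope_fin.
Qed.

Lemma polytope_slices (R : realType) m (P : set 'rV[R]_m) (s : seq 'rV[R]_m) :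
  polytope P -> polytope (P `&` [set x | forall l, l \in s -> pairing x l = 0]).
Proof.
move=> Ppoly; elim: s => [|l s IH].
  rewrite (_ : _ `&` _ = P) //; apply/seteqP; split=> [x []//|x Px].
  by split.
rewrite (_ : _ `&` _ = (P `&` [set x | forall l, l \in s -> pairing x l = 0])
  `&` [set x | pairing x l = 0]); first exact: polytope_slice.
apply/seteqP; split=> x /=.
  move=> [Px xl]; do !split=> //; last by apply: xl; rewrite mem_head.
  by move=> l' l's; apply: xl; rewrite inE l's orbT.
move=> [[Px xs] xl]; split=> // l'; rewrite inE => /orP[/eqP -> //|].
exact: xs.
Qed.

(** For the nontrivial inclusion, a relative interior point [x] of the section is
interior to a segment from [x0] to some [z] in the section; pushing a
neighbourhood of [x0] towards [z] gives a neighbourhood of [x]. *)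
Lemma relative_interior_slice (R : realType) m (S : set 'rV[R]_m)
    (L : set 'rV[R]_m) (x0 : 'rV[R]_m) :
  affine_hull L `<=` L -> relative_interior (convex_hull S) x0 -> L x0 ->
  relative_interior (convex_hull S `&` L) =
  relative_interior (convex_hull S) `&` L.
Proof.
move=> affL x0S Lx0; set P := convex_hull S.
have affPL : affine_hull (P `&` L) `<=` affine_hull P `&` L.
  move=> y Py; split; first by apply: sub_affine_hullP Py => z [].
  by apply: affL; apply: sub_affine_hullP Py => z [].
apply/seteqP; split=> x; last first.
  move=> [[Px nearP] Lx]; split=> //.
  by apply: filterS nearP => y yP /affPL[Py Ly]; split=> //; exact: yP.
move=> xPL; have [[Px Lx] _] := xPL; split=> //.
have x0PL : affine_hull (P `&` L) x0 by apply: sub_affine_hull; split=> //; case: x0S.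
have [e e0 [Pz _]] := relative_interior_extend xPL x0PL.
set z := x + _ in Pz; split=> //.
have e1 : 0 < 1 + e by rewrite addr_gt0.
(* back undoes the push towards z: x is the barycentre of z and x0 with
weights 1 / (1 + e) and e / (1 + e) *)
pose back (y : 'rV[R]_m) := ((1 + e) / e) *: y + (- e^-1) *: z.
have back_cvg : back y @[y --> x] --> x0.
  have : back y @[y --> x] --> back x.
    exact: (cvgD (cvgZ (cvg_cst _) cvg_id) (cvg_cst _)).
  rewrite (_ : back x = x0) // /back /z scalerDr scalerA.
  rewrite mulNr mulVf ?gt_eqF // scaleN1r opprB addrA -scalerDl.
  rewrite (_ : (1 + e) / e - _ = 1); last by field; rewrite gt_eqF.
  by rewrite scale1r addrC subrK.
have [_ nearP] := x0S; have := back_cvg _ nearP.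
apply: (@filterS _ (nbhs x)) => y yP affy.
have -> : y = (e / (1 + e)) *: back y + (1 + e)^-1 *: z.
  rewrite /back scalerDr !scalerA addrAC -addrA -scalerDl.
  rewrite (_ : _ * _ = 1); last by field; rewrite !gt_eqF.
  rewrite (_ : (1 + e)^-1 + _ = 0); last by field; rewrite !gt_eqF.
  by rewrite scale1r scale0r addr0.
apply: convex_hull_comb => //.
- by rewrite divr_ge0 // ltW.
- by rewrite invr_ge0 ltW.
- by field; rewrite gt_eqF.
- apply: yP; apply: affine_hull_comb => //; first by field; rewrite gt_eqF.
  exact: sub_affine_hull.
Qed.

(** * Tight frames and the planes spanned by their vectors *)

Section Dot.
Variables (R : realType) (d : nat).
Implicit Types (x y z : 'cV[R]_d).

Lemma dotC x y : dot x y = dot y x.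
Proof. by apply: eq_bigr => k _; rewrite mulrC. Qed.

Lemma dotDl x y z : dot (x + y) z = dot x z + dot y z.
Proof. by rewrite -big_split; apply: eq_bigr => k _; rewrite mxE mulrDl. Qed.

Lemma dotZl (a : R) x y : dot (a *: x) y = a * dot x y.
Proof. by rewrite /dot mulr_sumr; apply: eq_bigr => k _; rewrite mxE mulrA. Qed.

Lemma dotDr x y z : dot x (y + z) = dot x y + dot x z.
Proof. by rewrite !(dotC x) dotDl. Qed.

Lemma dotZr (a : R) x y : dot x (a *: y) = a * dot x y.
Proof. by rewrite !(dotC x) dotZl. Qed.

Lemma dotBl x y z : dot (x - y) z = dot x z - dot y z.
Proof. by rewrite dotDl -scaleN1r dotZl mulN1r. Qed.

Lemma dot0l y : dot 0 y = 0.
Proof. by rewrite -(scale0r (0 : 'cV[R]_d)) dotZl mul0r. Qed.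

Lemma dot_ge0 x : 0 <= dot x x.
Proof. by apply: sumr_ge0 => k _; rewrite -expr2 sqr_ge0. Qed.

Lemma dot_eq0 x : (dot x x == 0) = (x == 0).
Proof.
apply/idP/eqP => [|->]; last by rewrite dot0l.
rewrite psumr_eq0 => [/allP x0|k _]; last by rewrite -expr2 sqr_ge0.
apply/colP => k; have := x0 k (mem_index_enum _).
by rewrite /= mulf_eq0 orbb mxE => /eqP.
Qed.

Lemma dot_gt0 x : x != 0 -> 0 < dot x x.
Proof. by move=> x0; rewrite lt_def dot_eq0 x0 dot_ge0. Qed.

Lemma dotE x y : dot x y = (x^T *m y) 0 0.
Proof. by rewrite mxE; apply: eq_bigr => k _; rewrite mxE. Qed.

Lemma memv_pairP (x y v : 'cV[R]_d) :
  reflect (exists a b, v = a *: x + b *: y) (v \in <[x]> + <[y]>)%VS.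
Proof.
apply: (iffP memv_addP) => [[_ /vlineP[a ->] [_ /vlineP[b ->] ->]]|[a [b ->]]].
  by exists a, b.
by exists (a *: x); [|exists (b *: y)]; rewrite ?memvZ ?memv_line.
Qed.

(** The Gram-Schmidt process on two vectors. *)
Lemma orthonormal_plane x y : x != 0 -> (forall a, y != a *: x) ->
  exists e1 e2, [/\ dot e1 e1 = 1, dot e2 e2 = 1, dot e1 e2 = 0 &
    (<[x]> + <[y]> = <[e1]> + <[e2]>)%VS].
Proof.
move=> x0 yx.
have unit z : z != 0 -> exists2 a, a != 0 & dot (a *: z) (a *: z) = 1.
  move=> /dot_gt0 z0; exists (Num.sqrt (dot z z))^-1.
    by rewrite invr_eq0 gt_eqF // sqrtr_gt0.
  by rewrite dotZl dotZr mulrA -invfM -expr2 sqr_sqrtr ?ltW // mulVf ?gt_eqF.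
have [a a0 e1] := unit x x0; set e := a *: x in e1.
pose z := y - dot y e *: e.
have z0 : z != 0.
  by apply: contraNneq (yx (dot y e * a)) => /eqP; rewrite subr_eq0 scalerA.
have [b b0 e2] := unit z z0.
have ez : dot e z = 0 by rewrite dotC dotBl dotZl e1 mulr1 subrr.
exists e, (b *: z); split=> //; first by rewrite dotZr ez mulr0.
have xE : x = a^-1 *: e by rewrite /e scalerA mulVf // scale1r.
have yE : y = dot y e *: e + b^-1 *: (b *: z).
  by rewrite (scalerA b^-1) mulVf // scale1r addrC subrK.
apply/eqP; rewrite eqEsubv !subv_add -!memvE; apply/andP; split; apply/andP; split.
- by apply/memv_pairP; exists a^-1, 0; rewrite scale0r addr0.
- by apply/memv_pairP; exists (dot y e), b^-1.
- by apply/memv_pairP; exists a, 0; rewrite scale0r addr0.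
- apply/memv_pairP; exists (- (b * dot y e * a)), b.
  by rewrite /z scalerBr /e !scalerA mulrA scaleNr addrC.
Qed.

End Dot.

Section Lines.
Variables (R : realType) (d n : nat).
Implicit Types (A B : 'M[R]_(d, n)) (i j k l : 'I_n) (L : {set 'I_n}).

Definition plane A i j := (<[col i A]> + <[col j A]>)%VS.

(** Seen projectively, the vectors of [A] are points, and their index sets in
common planes are the lines spanned by these points. *)
Definition line A i j : {set 'I_n} := cols_in A (plane A i j).

Definition lines A : {set {set 'I_n}} :=
  [set line A p.1 p.2 | p in [set p : 'I_n * 'I_n | p.1 != p.2]]%SET.

Definition rich_lines A : {set {set 'I_n}} := [set L in lines A | (3 <= #|L|)%N]%SET.

Lemma linesP A L : reflect (exists i j, i != j /\ L = line A i j) (L \in lines A).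
Proof.
apply: (iffP imsetP) => [[[i j]]|[i [j [ij ->]]]].
  by rewrite inE /= => ij ->; exists i, j.
by exists (i, j); rewrite ?inE.
Qed.

Lemma line_l A i j : i \in line A i j.
Proof. by rewrite inE; apply/memv_pairP; exists 1, 0; rewrite scale1r scale0r addr0. Qed.

Lemma line_r A i j : j \in line A i j.
Proof. by rewrite inE; apply/memv_pairP; exists 0, 1; rewrite scale1r scale0r add0r. Qed.

Section Configuration.
Variable A : 'M[R]_(d, n).
Hypothesis A_nz : nonzero_cols A.
Hypothesis A_np : nonproportional_cols A.

Lemma dim_plane i j : i != j -> \dim (plane A i j) = 2%N.
Proof.
move=> ij; rewrite dimv_disjoint_sum ?dim_vline ?A_nz //.
apply/eqP; rewrite -subv0; apply/subvP => v; rewrite memv_cap memv0.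
move=> /andP[/vlineP[a ->] /vlineP[b aib]].
have [->|a0] := eqVneq a 0; first by rewrite scale0r.
have := A_np ij (a^-1 * b).
by rewrite -scalerA -aib scalerA mulVf // scale1r eqxx.
Qed.

Lemma plane_eq i j (Pi : {vspace 'cV[R]_d}) : i != j -> \dim Pi = 2%N ->
  col i A \in Pi -> col j A \in Pi -> plane A i j = Pi.
Proof.
move=> ij dimPi iPi jPi; apply/eqP.
by rewrite eqEdim dim_plane // dimPi leqnn subv_add -!memvE iPi jPi.
Qed.

Lemma line_eq i j k l : i != j -> k != l -> k \in line A i j -> l \in line A i j ->
  line A k l = line A i j.
Proof.
rewrite !inE => ij kl kP lP.
by rewrite /line (plane_eq kl (dim_plane ij) kP lP).
Qed.

(** The lines through a point partition the other points. *)
Lemma sum_lines_through (V : nmodType) i (g : 'I_n -> V) :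
  \sum_(j | j != i) g j = \sum_(L in lines A | i \in L) \sum_(j in L | j != i) g j.
Proof.
rewrite (partition_big (line A i) (fun L => (L \in lines A) && (i \in L))) /=.
  apply: eq_bigr => L /andP[/linesP[k [l [kl ->]]] iL]; apply: eq_bigl => j.
  rewrite andbC; have [ji|_] := boolP (j != i); rewrite ?andbF // !andbT.
  apply/eqP/idP => [<-|jL]; first exact: line_r.
  by rewrite (line_eq kl _ iL jL) // eq_sym.
by move=> j ji; rewrite line_l andbT; apply/linesP; exists i, j; rewrite eq_sym.
Qed.

End Configuration.

Lemma line_projectively_equivalent A B i j :
  projectively_equivalent A B -> line B i j = line A i j.
Proof.
move=> [F [lam [Fu lam0 BE]]]; apply/setP => k; rewrite !inE.
apply/memv_pairP/memv_pairP => -[a [b kE]].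
  exists ((lam k)^-1 * a * lam i), ((lam k)^-1 * b * lam j).
  apply: (can_inj (mulKmx Fu)).
  rewrite mulmxDr -!scalemxAr -2!mulrA -!scalerA -!BE.
  have -> : F *m col k A = (lam k)^-1 *: col k B by rewrite BE scalerA mulVf ?scale1r.
  by rewrite -scalerDr kE.
exists (lam k * a / lam i), (lam k * b / lam j).
rewrite !BE !scalerA !divfK // kE mulmxDr -!scalemxAr scalerDr !scalerA.
by [].
Qed.

Lemma lines_projectively_equivalent A B :
  projectively_equivalent A B -> rich_lines B = rich_lines A.
Proof.
move=> AB; apply/setP => L; rewrite !inE; congr (_ && _).
by apply/linesP/linesP => -[i [j [ij ->]]]; exists i, j;
   rewrite ?(line_projectively_equivalent _ _ AB).
Qed.

End Lines.

Section VeeSystems.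
Variables (R : realType) (d n : nat).
Implicit Types (A B : 'M[R]_(d, n)) (i j k l : 'I_n) (L : {set 'I_n}).

Definition weight B i : R := dot (col i B) (col i B).

Lemma gramE B (x : 'cV[R]_d) :
  \sum_i dot x (col i B) ^+ 2 = (x^T *m (B *m B^T) *m x) 0 0.
Proof.
rewrite mulmxA -mulmxA -[B^T *m x]trmxK trmx_mul trmxK mxE.
apply: eq_bigr => i _; rewrite [(_^T) i 0]mxE expr2.
suff -> : (x^T *m B) 0 i = dot x (col i B) by [].
by rewrite mxE; apply: eq_bigr => k _; rewrite !mxE.
Qed.

(** Polarization: a symmetric matrix whose quadratic form vanishes is 0. *)
Lemma V1P B : V1 B <-> B *m B^T = 1%:M.
Proof.
split=> [BV1|BB x]; last by rewrite gramE BB mulmx1 dotE.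
pose N := B *m B^T - 1%:M.
have Nsym : N^T = N by rewrite linearB /= trmx_mul trmxK trmx1.
have N0 (x : 'cV[R]_d) : (x^T *m N *m x) 0 0 = 0.
  by rewrite mulmxBr mulmx1 mulmxBl mxE -gramE BV1 dotE !mxE subrr.
suff : N = 0 by move/eqP; rewrite subr_eq0 => /eqP.
clearbody N; have bil (x y : 'cV[R]_d) : (x^T *m N *m y) 0 0 = 0.
  have yx : (y^T *m N *m x) 0 0 = (x^T *m N *m y) 0 0.
    by rewrite -[y^T *m N *m x]trmxK mxE !trmx_mul trmxK Nsym mulmxA.
  have := N0 (x + y); rewrite [(x + y)^T]linearD /= !(mulmxDl, mulmxDr).
  have addE (M M' : 'M[R]_(1, 1)) : (M + M') 0 0 = M 0 0 + M' 0 0 by rewrite mxE.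
  by rewrite !addE !N0 yx; lra.
apply/matrixP => i j.
have := bil (delta_mx i 0) (delta_mx j 0).
by rewrite trmx_delta -rowE -colE !mxE.
Qed.

Lemma sum_weight B : V1 B -> \sum_i weight B i = d%:R.
Proof.
move=> /V1P BB; transitivity (\tr (B *m B^T)); last by rewrite BB mxtrace1.
rewrite /mxtrace /weight /dot exchange_big; apply: eq_bigr => k _.
by rewrite mxE; apply: eq_bigr => i _; rewrite !mxE.
Qed.

(** By [V2] the quadratic form of the vectors in [L] is [nu] times the squared
norm on their plane, where taking traces forces [nu] to be half the total weight
of [L]; this is the resulting error at [beta_i]. *)
Definition excess B L i :=
  \sum_(j in L) dot (col i B) (col j B) ^+ 2
  - 2^-1 * (\sum_(j in L) weight B j) * weight B i.

(** The vanishing of the partial derivatives of the Hirzebruch form at the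
weights of a tight frame, whose sum is [d]. *)
Definition critical_weights B := forall i,
  \sum_(L in rich_lines B | i \in L)
    (2^-1 * (\sum_(k in L) weight B k) - weight B i) + weight B i = 1.

Section Frame.
Variable B : 'M[R]_(d, n).
Hypotheses (B_nz : nonzero_cols B) (B_np : nonproportional_cols B) (B_V1 : V1 B).

Lemma line_coordinates i j : i != j -> exists e1 e2 (a b : 'I_n -> R),
  [/\ dot e1 e1 = 1, dot e2 e2 = 1, dot e1 e2 = 0,
     (plane B i j = <[e1]> + <[e2]>)%VS
   & forall k, k \in line B i j -> col k B = a k *: e1 + b k *: e2].
Proof.
move=> ij; have [|e1 [e2 [e11 e22 e12 planeE]]] :=
  @orthonormal_plane _ _ (col i B) (col j B) (B_nz i).
  by move=> c; apply: B_np; rewrite eq_sym.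
exists e1, e2, (fun k => dot (col k B) e1), (fun k => dot (col k B) e2).
split=> // k; rewrite inE /plane planeE => /memv_pairP[a [b ->]].
by rewrite !dotDl !dotZl e11 e22 e12 (dotC e2) e12 !mulr0 !mulr1 addr0 add0r.
Qed.

(** In orthonormal coordinates [(a k, b k)] on the plane, the total excess is
[(p - q)^2 / 2 + 2 r^2], the squared norm of the trace-free part of the matrix
with diagonal [p], [q] and off-diagonal entry [r]. *)
Lemma excess_sum_line i j : i != j -> let L := line B i j in
  0 <= \sum_(k in L) excess B L k /\
  (\sum_(k in L) excess B L k = 0 ->
    exists nu, forall x, x \in plane B i j ->
      \sum_(k in L) dot x (col k B) ^+ 2 = nu * dot x x).
Proof.
move=> ij L; have [e1 [e2 [a [b [e11 e22 e12 planeE colE]]]]] := line_coordinates ij.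
have dot_coord x1 x2 k : k \in L ->
    dot (x1 *: e1 + x2 *: e2) (col k B) = x1 * a k + x2 * b k.
  move=> /colE ->; rewrite !dotDl !dotDr !dotZl !dotZr e11 e22 e12 (dotC e2) e12.
  by ring.
pose p := \sum_(k in L) a k ^+ 2; pose q := \sum_(k in L) b k ^+ 2.
pose r := \sum_(k in L) a k * b k.
have sum_sq x1 x2 : \sum_(k in L) (x1 * a k + x2 * b k) ^+ 2 =
    x1 ^+ 2 * p + x2 ^+ 2 * q + 2 * x1 * x2 * r.
  rewrite !mulr_sumr -!big_split; apply: eq_bigr => k _ /=; ring.
have weightE k : k \in L -> weight B k = a k ^+ 2 + b k ^+ 2.
  by move=> kL; rewrite /weight {1}(colE k kL) dot_coord // !expr2.
have W : \sum_(k in L) weight B k = p + q.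
  by rewrite (eq_bigr _ weightE) big_split.
have excessE : \sum_(k in L) excess B L k = 2^-1 * (p - q) ^+ 2 + 2 * r ^+ 2.
  have termE k : k \in L -> excess B L k = a k ^+ 2 * (p - 2^-1 * (p + q)) +
      b k ^+ 2 * (q - 2^-1 * (p + q)) + a k * b k * (2 * r).
    move=> kL; rewrite /excess weightE // W (colE k kL).
    under eq_bigr => l lL do rewrite dot_coord //.
    by rewrite sum_sq; ring.
  by rewrite (eq_bigr _ termE) !big_split /= -!mulr_suml -/p -/q -/r; field.
have pq_ge0 := sqr_ge0 (p - q); have r_ge0 := sqr_ge0 r.
rewrite excessE; split=> [|sum0]; first by lra.
have /eqP : (p - q) ^+ 2 = 0 by lra.
rewrite sqrf_eq0 subr_eq0 => /eqP pq.
have /eqP : r ^+ 2 = 0 by lra.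
rewrite sqrf_eq0 => /eqP r0.
exists p => x; rewrite planeE => /memv_pairP[x1 [x2 ->]].
under eq_bigr => k kL do rewrite dot_coord //.
rewrite sum_sq r0 -pq !dotDl !dotDr !dotZl !dotZr e11 e22 e12 (dotC e2) e12.
by ring.
Qed.

(** Evaluating the hypothesis at an orthonormal basis gives the total weight
[2 nu]. *)
Lemma isotropic_line_excess i j nu : i != j ->
  (forall x, x \in plane B i j ->
     \sum_(k in line B i j) dot x (col k B) ^+ 2 = nu * dot x x) ->
  forall k, k \in line B i j -> excess B (line B i j) k = 0.
Proof.
move=> ij nuP; have [e1 [e2 [a [b [e11 e22 e12 planeE colE]]]]] := line_coordinates ij.
have W : \sum_(k in line B i j) weight B k = 2 * nu.
  have e1P : e1 \in plane B i j.
    by rewrite planeE; apply/memv_pairP; exists 1, 0; rewrite scale1r scale0r addr0.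
  have e2P : e2 \in plane B i j.
    by rewrite planeE; apply/memv_pairP; exists 0, 1; rewrite scale1r scale0r add0r.
  transitivity (nu * dot e1 e1 + nu * dot e2 e2); last by rewrite e11 e22; ring.
  rewrite -!nuP // -big_split; apply: eq_bigr => k kL.
  rewrite /weight (colE k kL) !dotDl !dotDr !dotZl !dotZr e11 e22 e12 (dotC e2) e12.
  by rewrite /=; ring.
move=> k kL; rewrite /excess nuP; last by move: kL; rewrite inE.
by rewrite W mulKf ?subrr // pnatr_eq0.
Qed.

(** The first sum measures the failure of (V2) at [beta_i], the second that of
(V3). *)
Definition defect i :=
  \sum_(L in rich_lines B | i \in L) excess B L i +
  \sum_(L in lines B | (i \in L) && (#|L| < 3)%N)
    \sum_(j in L | j != i) dot (col i B) (col j B) ^+ 2.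

(** Splitting (V1) at [beta_i] by the planes through it identifies the defect with
the equation of index [i] times the weight. *)
Lemma defect_critical : critical_weights B <-> forall i, defect i = 0.
Proof.
suff key i : defect i = weight B i * (1 -
  (\sum_(L in rich_lines B | i \in L)
    (2^-1 * (\sum_(k in L) weight B k) - weight B i) + weight B i)).
  split=> [bal i|def0 i]; first by rewrite key bal subrr mulr0.
  have /eqP := def0 i; rewrite key mulf_eq0 gt_eqF ?dot_gt0 //= subr_eq0.
  by move=> /eqP.
have wi2 : weight B i ^+ 2 + \sum_(j | j != i) dot (col i B) (col j B) ^+ 2 = weight B i.
  by rewrite -[RHS]B_V1 [RHS](bigD1 i).
rewrite (sum_lines_through B_nz B_np) (bigID (fun L => (3 <= #|L|)%N)) /= in wi2.
have richE L : (L \in lines B) && (i \in L) && (3 <= #|L|)%N =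
    (L \in rich_lines B) && (i \in L) by rewrite [in RHS]inE andbAC.
have poorE L : (L \in lines B) && (i \in L) && ~~ (3 <= #|L|)%N =
    (L \in lines B) && ((i \in L) && (#|L| < 3)%N) by rewrite -andbA -ltnNge.
rewrite (eq_bigl _ _ richE) (eq_bigl _ _ poorE) in wi2.
have -> : defect i = \sum_(L in rich_lines B | i \in L)
      \sum_(j in L | j != i) dot (col i B) (col j B) ^+ 2
    - weight B i * (\sum_(L in rich_lines B | i \in L)
      (2^-1 * (\sum_(k in L) weight B k) - weight B i))
    + \sum_(L in lines B | (i \in L) && (#|L| < 3)%N)
      \sum_(j in L | j != i) dot (col i B) (col j B) ^+ 2.
  congr (_ + _); rewrite mulr_sumr -sumrB; apply: eq_bigr => L /andP[_ iL].
  rewrite /excess (bigD1 i) //= -/(weight B i); set W := \sum_(_ in L) weight B _.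
  by ring.
by lra.
Qed.

(** A single defect has no sign, but the sum of the defects over [i] is a sum of
nonnegative contributions of the lines. *)
Lemma vee_system_critical : euclidean_vee_system B <-> critical_weights B.
Proof.
rewrite defect_critical; split=> [[_ _ _ BV2 BV3] i|def0].
  rewrite /defect big1 ?add0r => [|L /andP[]]; last first.
    rewrite inE => /andP[/linesP[k [l [kl ->]]] card3] iL.
    have [nu nuP] := BV2 _ (dim_plane B_nz B_np kl) card3.
    exact: (isotropic_line_excess kl nuP).
  apply: big1 => L /andP[/linesP[k [l [kl ->]]] /andP[iL card3]].
  apply: big1 => j /andP[jL ji].
  have Lij := line_eq B_nz B_np kl ji jL iL.
  rewrite (BV3 (plane B j i) i j) ?expr0n //; [exact: dim_plane | by rewrite eq_sym|].
  rewrite -/(line B j i) Lij; apply/esym/eqP.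
  rewrite eqEcard finset.subUset !finset.sub1set iL jL /=.
  by rewrite cards2 eq_sym ji -ltnS.
have excess_ge0 L : L \in rich_lines B -> 0 <= \sum_(i in L) excess B L i.
  by rewrite inE => /andP[/linesP[k [l [kl ->]]] _]; exact: (excess_sum_line kl).1.
have sum0 : \sum_(L in rich_lines B) \sum_(i in L) excess B L i +
   \sum_i \sum_(L in lines B | (i \in L) && (#|L| < 3)%N)
    \sum_(j in L | j != i) dot (col i B) (col j B) ^+ 2 = 0.
  rewrite (exchange_big_dep xpredT) //= -big_split big1 // => i _.
  exact: def0.
have poor_ge0 i : 0 <= \sum_(L in lines B | (i \in L) && (#|L| < 3)%N)
    \sum_(j in L | j != i) dot (col i B) (col j B) ^+ 2.
  by apply: sumr_ge0 => L _; apply: sumr_ge0 => j _; rewrite sqr_ge0.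
move/eqP: sum0; rewrite paddr_eq0 ?sumr_ge0 // => /andP[/eqP rich0 /eqP poor0].
split=> // [Pi dimPi card3|Pi i j dimPi ij PiE].
  have [i iPi] : exists i, i \in cols_in B Pi.
    by apply/card_gt0P; rewrite (leq_trans _ card3).
  have [j jPi ij] : exists2 j, j \in cols_in B Pi & i != j.
    have : (0 < #|cols_in B Pi :\ i|)%N.
      by move: card3; rewrite (cardsD1 i) iPi add1n ltnS; apply: leq_trans.
    case/card_gt0P => j; rewrite !inE => /andP[ji jPi].
    by exists j; rewrite ?inE // eq_sym.
  move: iPi jPi; rewrite !inE => iPi jPi.
  have PiE := plane_eq B_nz B_np ij dimPi iPi jPi; rewrite -PiE.
  apply: (excess_sum_line ij).2; apply: (psumr_eq0P excess_ge0) rich0 _ _.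
  by rewrite inE; apply/andP; split; [apply/linesP; exists i, j | rewrite /line PiE].
have iL : i \in cols_in B Pi by rewrite PiE !inE eqxx.
have jL : j \in cols_in B Pi by rewrite PiE !inE eqxx orbT.
move: iL jL; rewrite !inE => iPi jPi.
have planeE := plane_eq B_nz B_np ij dimPi iPi jPi.
have lineE : line B i j = [set i; j]%SET by rewrite /line planeE.
have /(_ i isT) poor_i := psumr_eq0P (fun i _ => poor_ge0 i) poor0.
have poor_line : \sum_(k in line B i j | k != i) dot (col i B) (col k B) ^+ 2 = 0.
  apply: (psumr_eq0P _ poor_i) => [L _|].
    by apply: sumr_ge0 => k _; rewrite sqr_ge0.
  rewrite line_l; apply/andP; split; first by apply/linesP; exists i, j.
  by rewrite lineE cards2 ij.
have /(_ j) := psumr_eq0P (fun k _ => sqr_ge0 _) poor_line.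
rewrite line_r eq_sym ij => /(_ isT)/eqP.
by rewrite sqrf_eq0 => /eqP.
Qed.

End Frame.
End VeeSystems.

(** * The Hirzebruch form of an arrangement *)

Section Flats.
Variables (R : realType) (d n : nat) (A : 'M[R]_(d, n)).
Hypotheses (A_nz : nonzero_cols A) (A_np : nonproportional_cols A).
Implicit Types (i j k : 'I_n) (L : {set 'I_n}).

Notation H := (dual_arrangement A).

(** The orthogonal projection to the plane of two vectors, with its kernel
described by the arrangement. *)
Lemma orthogonal_decomposition i j : i != j ->
  exists proj : 'cV[R]_d -> 'cV[R]_d, forall x,
    [/\ proj x \in plane A i j, x - proj x \in (H i :&: H j)%VS
      & forall y, y \in plane A i j -> dot y (x - proj x) = 0].
Proof.
move=> ij; have [|e1 [e2 [e11 e22 e12 planeE]]] :=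
  @orthonormal_plane _ _ (col i A) (col j A) (A_nz i).
  by move=> c; apply: A_np; rewrite eq_sym.
exists (fun x => dot x e1 *: e1 + dot x e2 *: e2) => x.
set r := x - _.
have perp y : y \in plane A i j -> dot y r = 0.
  rewrite /plane planeE => /memv_pairP[a [b ->]].
  rewrite dotC dotBl !dotDl !dotDr !dotZl !dotZr e11 e22 e12 (dotC e2) e12.
  by ring.
split=> //.
  by rewrite /plane planeE; apply/memv_pairP; exists (dot x e1), (dot x e2).
rewrite memv_cap; apply/andP; split; rewrite mem_orthogonal_hyperplane;
  apply/eqP; rewrite dotC; apply: perp; [have := line_l A i j | have := line_r A i j];
  by rewrite inE.
Qed.

Lemma perp_plane i j y x : y \in plane A i j -> x \in (H i :&: H j)%VS -> dot y x = 0.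
Proof.
move=> /memv_pairP[a [b ->]]; rewrite memv_cap !mem_orthogonal_hyperplane.
by move=> /andP[/eqP xi /eqP xj]; rewrite dotC dotDr !dotZr xi xj !mulr0 addr0.
Qed.

Lemma mem_line_meet i j k : i != j ->
  (k \in line A i j) = (H i :&: H j <= H k)%VS.
Proof.
move=> ij; rewrite inE; apply/idP/subvP => [kP x xS|HS].
  by rewrite mem_orthogonal_hyperplane dotC (perp_plane kP xS).
have [proj projP] := orthogonal_decomposition ij.
have [pP rS perp] := projP (col k A); have := HS _ rS.
rewrite mem_orthogonal_hyperplane => /eqP rk.
suff /eqP : dot (col k A - proj (col k A)) (col k A - proj (col k A)) = 0.
  by rewrite dot_eq0 subr_eq0 => /eqP ->.
by rewrite dotBl (perp _ pP) dotC rk subrr.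
Qed.

Lemma dim_meet i j : i != j -> (\dim (H i :&: H j) + 2)%N = d.
Proof.
move=> ij; rewrite -(dim_plane A_nz A_np ij) -dimv_disjoint_sum.
  rewrite (_ : (_ + _)%VS = fullv) ?dimvf /dim /= ?muln1 //.
  apply/eqP; rewrite eqEsubv subvf; apply/subvP => x _.
  have [proj projP] := orthogonal_decomposition ij; have [pP rS _] := projP x.
  by rewrite -[x](subrK (proj x)) memv_add.
apply/eqP; rewrite -subv0; apply/subvP => v; rewrite memv_cap memv0.
by move=> /andP[vS vP]; rewrite -dot_eq0 (perp_plane vP vS).
Qed.

(** Orthogonal complement exchanges planes and subspaces of codimension 2: the
flats correspond to the lines with at least three points. A flat is recovered
from its line as the intersection of the hyperplanes containing it. *)
Lemma flats_lines :
  perm_eq [seq [set i | (U <= H i)%VS]%SET | U <- codim2_flats H]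
          (enum (rich_lines A)).
Proof.
apply: uniq_perm; last 2 first.
- exact: enum_uniq.
- move=> L; rewrite mem_enum.
  apply/mapP/idP => [[S /mem_codim2_flats[J [J3 SE dimS]] ->]|].
    have [i iJ] : exists i, i \in J by apply/card_gt0P; rewrite (leq_trans _ J3).
    have [j jJ ij] : exists2 j, j \in J & i != j.
      have : (0 < #|J :\ i|)%N.
        by move: J3; rewrite (cardsD1 i) iJ add1n ltnS; apply: leq_trans.
      by case/card_gt0P => j; rewrite !inE => /andP[ji jJ]; exists j; rewrite // eq_sym.
    have SJ k : k \in J -> (S <= H k)%VS.
      by move=> kJ; rewrite SE; exact: bigcapv_inf kJ _.
    have Sij : S = (H i :&: H j)%VS.
      apply/eqP; rewrite eqEdim subv_cap !SJ //=.
      by rewrite -(leq_add2r 2) dimS dim_meet.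
    rewrite inE (_ : [set k | _]%SET = line A i j); last first.
      by apply/setP => k; rewrite [LHS]inE mem_line_meet // Sij.
    apply/andP; split; first by apply/linesP; exists i, j.
    apply: leq_trans J3 (subset_leq_card _); apply/fintype.subsetP => k /SJ.
    by rewrite mem_line_meet // -Sij.
  rewrite inE => /andP[/linesP[i [j [ij LE]]] L3].
  exists (H i :&: H j)%VS; last by apply/setP => k; rewrite inE LE mem_line_meet.
  apply/mem_codim2_flats; exists L; split=> //; last exact: dim_meet.
  apply/eqP; rewrite eqEsubv; apply/andP; split.
    by apply/subv_bigcapP => k; rewrite LE mem_line_meet.
  have meet_le k : k \in L -> (\bigcap_(i in L) H i <= H k)%VS.
    by move=> kL; exact: bigcapv_inf kL _.
  by rewrite subv_cap !meet_le ?LE ?line_l ?line_r.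
rewrite map_inj_in_uniq ?undup_uniq // => S S' flatS flatS' SS'.
have flatE T : T \in codim2_flats H ->
    T = (\bigcap_(i in [set i | (T <= H i)%VS]%SET) H i)%VS.
  move=> /mem_codim2_flats[J [_ TE _]]; apply/eqP; rewrite eqEsubv; apply/andP; split.
    by apply/subv_bigcapP => k; rewrite inE.
  rewrite [X in (_ <= X)%VS]TE; apply/subv_bigcapP => k kJ.
  have kT : k \in [set i | (T <= H i)%VS]%SET by rewrite inE TE; exact: bigcapv_inf kJ _.
  exact: bigcapv_inf kT _.
by rewrite (flatE S) // (flatE S') // SS'.
Qed.

Lemma sum_flats (V : nmodType) (F : {set 'I_n} -> V) :
  \sum_(S <- codim2_flats H) F [set i | (S <= H i)%VS]%SET =
  \sum_(L in rich_lines A) F L.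
Proof. by rewrite -big_enum /= -(perm_big _ flats_lines) big_map. Qed.

(** The rows of the symmetric matrix of the form. *)
Definition hirzebruch_row i : 'rV[R]_n := \row_j
  (4^-1 * \sum_(L in rich_lines A) (i \in L)%:R * (j \in L)%:R
   - 2^-1 * (i == j)%:R * (\sum_(L in rich_lines A) (i \in L)%:R - 1)
   - (2 * d%:R)^-1).

Lemma pairing_hirzebruch_row w i : pairing w (hirzebruch_row i) =
  4^-1 * (\sum_(L in rich_lines A) (i \in L)%:R * \sum_(j in L) w 0 j)
  - 2^-1 * w 0 i * (\sum_(L in rich_lines A) (i \in L)%:R - 1)
  - (2 * d%:R)^-1 * \sum_j w 0 j.
Proof.
rewrite /pairing; under eq_bigr => j _ do rewrite mxE 2!mulrBr.
rewrite !sumrB; congr (_ - _ - _).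
- under eq_bigr => j _ do rewrite mulrCA mulr_sumr.
  rewrite -mulr_sumr exchange_big; congr (_ * _); apply: eq_bigr => L _ /=.
  rewrite mulr_sumr [RHS]big_mkcond; apply: eq_bigr => j _ /=.
  by case: (j \in L); rewrite /= ?mulr1 ?mulr0 // mulrC.
- rewrite (bigD1 i) //= eqxx [X in _ + X]big1 ?addr0 => [|j ji].
    by rewrite mulr1 mulrCA mulrA.
  by rewrite eq_sym (negPf ji) mulr0 mul0r mulr0.
- by rewrite -mulr_suml mulrC.
Qed.

Lemma hirzebruch_formE w :
  hirzebruch_form H w = \sum_i w 0 i * pairing w (hirzebruch_row i).
Proof.
have flatE (U : {vspace 'cV[R]_d}) : flat_weight H w U =
    2^-1 * \sum_(i in [set i | (U <= H i)%VS]%SET) w 0 i.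
  by rewrite /flat_weight; congr (_ * _); apply: eq_bigl => i; rewrite inE.
have numE i : (num_flats_in H i)%:R = \sum_(L in rich_lines A) (i \in L)%:R :> R.
  rewrite -sum_flats /num_flats_in -sum1_count natr_sum big_mkcond /=.
  by apply: eq_bigr => U _; rewrite inE; case: (_ <= _)%VS.
rewrite /hirzebruch_form; under eq_bigr do rewrite flatE.
rewrite (sum_flats (fun L => (2^-1 * \sum_(i in L) w 0 i) ^+ 2)).
under [X in _ - 2^-1 * X]eq_bigr do rewrite numE.
under [RHS]eq_bigr do rewrite pairing_hirzebruch_row 2!mulrBr.
rewrite !sumrB; congr (_ - _ - _).
- under [RHS]eq_bigr do rewrite mulrCA mulr_sumr.
  rewrite -mulr_sumr exchange_big mulr_sumr; apply: eq_bigr => L _ /=.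
  set W := \sum_(j in L) w 0 j.
  have -> : \sum_i w 0 i * ((i \in L)%:R * W) = W * W; last by field.
  rewrite {2}/W mulr_suml [RHS]big_mkcond; apply: eq_bigr => i _.
  by case: (i \in L); rewrite ?mul1r // mul0r mulr0.
- by rewrite mulr_sumr; apply: eq_bigr => i _; ring.
- by rewrite -mulr_suml expr2 mulrCA.
Qed.

Lemma hirzebruch_row_sym i j : hirzebruch_row i 0 j = hirzebruch_row j 0 i.
Proof.
rewrite !mxE; congr (_ - _ - _).
  by congr (_ * _); apply: eq_bigr => L _; rewrite mulrC.
by have [->|ij] := eqVneq i j; rewrite // mulr0 !mul0r.
Qed.

Lemma form_kernel_hirzebruch u :
  form_kernel (hirzebruch_form H) u <-> forall i, pairing u (hirzebruch_row i) = 0.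
Proof.
have polarE v : polar_form (hirzebruch_form H) u v =
    \sum_i v 0 i * pairing u (hirzebruch_row i).
  have swap : \sum_i u 0 i * pairing v (hirzebruch_row i) =
              \sum_i v 0 i * pairing u (hirzebruch_row i).
    under eq_bigr do rewrite mulr_sumr.
    rewrite exchange_big; apply: eq_bigr => i _; rewrite mulr_sumr.
    by apply: eq_bigr => j _; rewrite hirzebruch_row_sym mulrCA.
  rewrite /polar_form !hirzebruch_formE.
  under eq_bigr => i _ do rewrite mxE pairingDl mulrDl !mulrDr.
  by rewrite !big_split /= swap; field.
split=> [ku i|u0 v]; last by rewrite polarE big1 // => i _; rewrite u0 mulr0.
rewrite -[RHS](ku (delta_mx 0 i)) polarE (bigD1 i) //= mxE !eqxx mul1r.
by rewrite big1 ?addr0 // => j ji; rewrite mxE (negPf ji) andbF mul0r.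
Qed.

End Flats.

(** The kernel is cut out by the rows of the matrix of the form. At the weights
of a tight frame, twice the pairing with the i-th row is the difference of the two
sides of the i-th equation of [critical_weights]. *)
Lemma form_kernel_vee (R : realType) d n (A B : 'M[R]_(d, n)) : (0 < d)%N ->
  nonzero_cols A -> nonproportional_cols A -> projectively_equivalent A B ->
  V1 B -> nonzero_cols B -> nonproportional_cols B ->
  form_kernel (hirzebruch_form (dual_arrangement A)) (\row_i weight B i) <->
  euclidean_vee_system B.
Proof.
move=> d0 A_nz A_np AB B_V1 B_nz B_np.
rewrite form_kernel_hirzebruch // vee_system_critical //.
have key i : 2 * pairing (\row_i weight B i) (hirzebruch_row A i) =
   \sum_(L in rich_lines B | i \in L)
    (2^-1 * (\sum_(k in L) weight B k) - weight B i) + weight B i - 1.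
  rewrite pairing_hirzebruch_row // (lines_projectively_equivalent AB) mxE.
  have -> : \sum_j (\row_k weight B k) 0 j = d%:R.
    by rewrite -(sum_weight B_V1); apply: eq_bigr => j _; rewrite mxE.
  under eq_bigr => L _ do under eq_bigr => j _ do rewrite mxE.
  have -> : \sum_(L in rich_lines A | i \in L)
      (2^-1 * (\sum_(k in L) weight B k) - weight B i) =
    2^-1 * (\sum_(L in rich_lines A) (i \in L)%:R * \sum_(k in L) weight B k) -
    (\sum_(L in rich_lines A) (i \in L)%:R) * weight B i.
    rewrite mulr_sumr mulr_suml -sumrB [LHS]big_mkcondr; apply: eq_bigr => L _.
    by case: (i \in L); rewrite ?mul1r // !mul0r mulr0 subrr.
  by field; rewrite pnatr_eq0 -lt0n.
split=> [ker i|bal i].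
  by apply/eqP; rewrite -subr_eq0 -key ker mulr0.
have := key i; rewrite (bal i) subrr => /eqP.
by rewrite mulf_eq0 pnatr_eq0 /= => /eqP.
Qed.

(** * Bases, irreducibility and scalings of a configuration *)

Section Bases.
Variables (R : realType) (d n : nat) (A : 'M[R]_(d, n)).
Implicit Types (f : {ffun 'I_d -> 'I_n}) (i j : 'I_n).

Definition basis_weight f : R := \det (colsub f A) ^+ 2.

Definition basis_indicator f : 'rV[R]_n := \row_i (i \in codom f)%:R.

Lemma basis_weight_ge0 f : 0 <= basis_weight f.
Proof. exact: sqr_ge0. Qed.

Lemma basis_weight_gt0 f : (0 < basis_weight f) = (colsub f A \in unitmx).
Proof. by rewrite lt_def basis_weight_ge0 andbT sqrf_eq0 unitmxE unitfE. Qed.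

Lemma basis_inj f : 0 < basis_weight f -> injective f.
Proof.
rewrite basis_weight_gt0 => fu k l fkl.
have : colsub f A *m delta_mx k 0 = colsub f A *m delta_mx l 0 :> 'cV_d.
  by apply/colP => m; rewrite -!colE !mxE fkl.
move=> /(can_inj (mulKmx fu))/matrixP/(_ k 0); rewrite !mxE !eqxx andbT /=.
by case: eqP => // _ /eqP; rewrite oner_eq0.
Qed.

Lemma pairing_basis_indicator f (u : 'rV[R]_n) : 0 < basis_weight f ->
  pairing (basis_indicator f) u = \sum_k u 0 (f k).
Proof.
move=> /basis_inj finj; rewrite /pairing.
rewrite (eq_bigr (fun i => if i \in codom f then u 0 i else 0)) => [|i _]; last first.
  by rewrite mxE; case: (_ \in _); rewrite ?mul1r ?mul0r.
by rewrite -big_mkcond -big_uniq ?big_image // map_inj_uniq ?enum_uniq.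
Qed.

Lemma spanning_annihilator (X : seq 'cV[R]_d) (v : 'rV[R]_d) :
  (<<X>> = fullv)%VS -> (forall x, x \in X -> v *m x = 0) -> v = 0.
Proof.
move=> spanX vX.
have Xker : (<<X>> <= lker (linfun (mulmx v : 'cV[R]_d -> 'M[R]_(1, 1))))%VS.
  by apply/span_subvP => x xX; rewrite memv_ker lfunE /= vX.
apply/rowP => k; have := subvP Xker (delta_mx k 0).
rewrite spanX memvf memv_ker lfunE /= -colE => /(_ isT)/eqP/matrixP/(_ 0 0).
by rewrite !mxE.
Qed.

Lemma basis_weight_spanning f : 0 < basis_weight f ->
  (<<[seq col (f k) A | k : 'I_d]>> = fullv)%VS.
Proof.
rewrite basis_weight_gt0 => fu; apply/eqP; rewrite eqEsubv subvf.
apply/subvP => x _; rewrite -(mulKVmx fu x); set y := invmx _ *m x.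
rewrite (_ : _ *m y = \sum_k y k 0 *: col (f k) A); last first.
  apply/colP => i; rewrite mxE summxE; apply: eq_bigr => k _.
  by rewrite !mxE mulrC.
apply: memv_suml => k _; rewrite memvZ // memv_span //.
by apply/fintype.imageP; exists k.
Qed.

(** Bases listed as injective functions instead of sets, to match the index type
of [cauchy_binet_sum]. *)
Lemma base_polytopeE : base_polytope A =
  convex_hull [set basis_indicator f | f in [set f | 0 < basis_weight f]].
Proof.
congr convex_hull; apply/seteqP; split=> [x [I [cardI basisI] <-]|x [f f0 <-]].
  pose f := [ffun k : 'I_d => enum_val (cast_ord (esym cardI) k)].
  have codomf i : (i \in codom f) = (i \in I).
    apply/codomP/idP => [[k ->]|iI]; first by rewrite ffunE enum_valP.
    exists (cast_ord cardI (enum_rank_in iI i)).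
    by rewrite ffunE cast_ordK enum_rankK_in.
  exists f; last by apply/rowP => i; rewrite !mxE codomf.
  rewrite /= basis_weight_gt0 -row_free_unit; apply: inj_row_free => v v0.
  apply: (spanning_annihilator (span_basis basisI)) => _ /fintype.imageP[i iI ->].
  have /codomP[k ->] : i \in codom f by rewrite codomf.
  apply/matrixP => a b; have /matrixP/(_ 0 k) := v0; rewrite !ord1 !mxE.
  by apply: etrans; apply: eq_bigr => l _; rewrite !mxE.
exists [set i in codom f]%SET; last by apply/rowP => i; rewrite !mxE inE.
have card_f : #|[set i in codom f]%SET| = d.
  by rewrite cardsE card_codom ?card_ord //; exact: basis_inj f0.
split=> //; rewrite basisEdim size_image card_f dimvf /dim /= muln1 leqnn andbT.
rewrite -(basis_weight_spanning f0); apply/span_subvP => _ /mapP[k _ ->].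
by rewrite memv_span //; apply/fintype.imageP; exists (f k); rewrite ?inE ?codom_f.
Qed.

(** By Cramer's rule the new minor is the old one times the k-th coordinate of
[alpha_j] in the basis. *)
Lemma basis_exchange f j k : 0 < basis_weight f ->
  (invmx (colsub f A) *m col j A) k 0 != 0 ->
  0 < basis_weight [ffun l => if l == k then j else f l].
Proof.
rewrite /basis_weight => f0; have := f0; rewrite basis_weight_gt0 => fu.
set y := _ *m _ => yk; set g := finfun _.
have -> : colsub g A = colsub f A *m (1%:M - (delta_mx k 0 - y) *m delta_mx 0 k).
  rewrite mulmxBr mulmx1 mulmxA mulmxBr (mulKVmx fu) -colE.
  apply/matrixP => a b; rewrite !mxE big_ord1 !mxE ffunE eqxx /=.
  by case: eqP => [->|_]; rewrite ?mulr1 ?mulr0 ?subr0 //; ring.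
rewrite det_mulmx det_1sub_rank1 exprMn pmulr_rgt0 // lt_def sqr_ge0 andbT.
have -> : ((delta_mx 0 k : 'rV_d) *m (delta_mx k 0 - y)) 0 0 = 1 - y k 0.
  by rewrite -rowE !mxE !eqxx.
by rewrite opprB addrC subrK sqrf_eq0.
Qed.

(** Fix a basis. When [alpha_j] has a nonzero coordinate along a basis vector,
exchanging the two shows that [u] takes the same value at both indices. So each
[alpha_j] is in the span of the basis vectors where [u] takes the value [u j],
and two different values would decompose the configuration. *)
Lemma irreducible_separating (u : 'rV[R]_n) (m : R) : (0 < d)%N ->
  nonzero_cols A -> irreducible_configuration A ->
  (exists f, 0 < basis_weight f) ->
  (forall f, 0 < basis_weight f -> pairing (basis_indicator f) u = m) ->
  exists a, u = const_mx a.
Proof.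
move=> d0 A_nz A_irr [f f0] um.
have := f0; rewrite basis_weight_gt0; set E := colsub f A => Eu.
pose y j := invmx E *m col j A; have yE j : E *m y j = col j A by rewrite mulKVmx.
have exchange j k : y j k 0 != 0 -> u 0 j = u 0 (f k).
  move=> yk; have g0 := basis_exchange f0 yk.
  have := um _ f0; rewrite -(um _ g0) !pairing_basis_indicator //.
  rewrite (bigD1 k) //= [RHS](bigD1 k) //= ffunE eqxx => /eqP.
  rewrite (eq_bigr (fun l => u 0 ([ffun l => if l == k then j else f l] l))).
    by rewrite (inj_eq (addIr _)) => /eqP.
  by move=> l lk; rewrite ffunE (negPf lk).
clearbody y; pose a : R := u 0 (f (Ordinal d0)); exists a.
pose D : 'M[R]_d := diag_mx (\row_k (u 0 (f k) == a)%:R).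
have DD : D *m D = D.
  rewrite mulmx_diag; congr diag_mx; apply/rowP => k; rewrite !mxE.
  by case: eqP; rewrite ?mulr1 ?mulr0.
(* the projection to the span of the basis vectors where u takes the value a,
along the span of the others *)
pose proj : 'M[R]_d := E *m D *m invmx E.
have projK : proj *m proj = proj.
  by rewrite /proj !mulmxA mulmxKV // -(mulmxA E) DD.
have projE j : proj *m col j A = E *m (D *m y j) by rewrite /proj -yE -!mulmxA mulKmx.
have Dy j : D *m y j = (u 0 j == a)%:R *: y j.
  apply/colP => k; rewrite mul_diag_mx !mxE.
  have [->|yk] := eqVneq (y j k 0) 0; first by rewrite !mulr0.
  by rewrite (exchange j k yk).
have proj_col j : proj *m col j A = (u 0 j == a)%:R *: col j A.
  by rewrite projE Dy -scalemxAr yE.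
clearbody proj; pose P := lker (linfun (mulmx (1%:M - proj) : 'cV[R]_d -> 'cV[R]_d)).
pose P' := lker (linfun (mulmx proj : 'cV[R]_d -> 'cV[R]_d)).
have memP x : (x \in P) = (proj *m x == x).
  by rewrite memv_ker lfunE /= mulmxBl mul1mx subr_eq0 eq_sym.
have memP' x : (x \in P') = (proj *m x == 0) by rewrite memv_ker lfunE.
apply/rowP => j; rewrite mxE; apply/eqP; apply: contra_notT A_irr => ja.
exists P, P'; split.
- apply: contraNneq (A_nz (f (Ordinal d0))) => P0.
  by rewrite -memv0 -P0 memP proj_col eqxx scale1r.
- apply: contraNneq (A_nz j) => P0.
  by rewrite -memv0 -P0 memP' proj_col (negPf ja) scale0r.
- apply/eqP; rewrite eqEsubv subvf; apply/subvP => x _.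
  rewrite -[x](subrK (proj *m x)) addrC memv_add // ?memP ?memP'.
    by rewrite mulmxA projK.
  by rewrite mulmxBr mulmxA projK subrr.
- rewrite directv_addE !directv_trivial /= -subv0.
  apply/subvP => x; rewrite memv_cap memP memP' memv0.
  by move=> /andP[/eqP ->].
- move=> i; rewrite memP memP' proj_col; case: (u 0 i == a).
    by rewrite scale1r eqxx.
  by rewrite scale0r eqxx orbT.
Qed.

End Bases.

Section Frames.
Variables (R : realType) (d n : nat) (A : 'M[R]_(d, n)).
Implicit Types (F : 'M[R]_d) (B C : 'M[R]_(d, n)) (t : 'rV[R]_n).

Notation c := (basis_weight A).
Notation p := (@basis_indicator R d n).

Lemma projectively_equivalentP B : projectively_equivalent A B <->
  exists F (lam : 'rV[R]_n),
    [/\ F \in unitmx, forall i, lam 0 i != 0 & B = F *m A *m diag_mx lam].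
Proof.
split=> [[F [lam [Fu lam0 BE]]]|[F [lam [Fu lam0 ->]]]].
  exists F, (\row_i lam i); split=> // [i|]; first by rewrite mxE.
  apply/matrixP => k i; have /colP/(_ k) := BE i.
  rewrite mul_mx_diag !mxE mulrC => ->; congr (_ * _).
  by apply: eq_bigr => l _; rewrite mxE.
exists F, (lam 0); split=> // i; apply/colP => k.
by rewrite mul_mx_diag !mxE mulrC; congr (_ * _); apply: eq_bigr => l _; rewrite mxE.
Qed.

Lemma colsub_scaled F (lam : 'rV[R]_n) (f : {ffun 'I_d -> 'I_n}) :
  colsub f (F *m A *m diag_mx lam) =
  F *m colsub f A *m diag_mx (\row_k lam 0 (f k)).
Proof.
apply/matrixP => k l; rewrite !mul_mx_diag !mxE.
by congr (_ * _); apply: eq_bigr => m _; rewrite mxE.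
Qed.

(** Scaling the columns by [lam] and applying [F] multiplies the minor of [f]
squared by [det F ^ 2 * exp <t, p f>]; the first factor cancels with the
partition function because the squared minors of a tight frame are
normalized. *)
Lemma weight_moment_map F (lam t : 'rV[R]_n) :
  (forall i, lam 0 i ^+ 2 = expR (t 0 i)) ->
  let B := F *m A *m diag_mx lam in B *m B^T = 1%:M ->
  \row_i weight B i = moment_map c p t.
Proof.
move=> lamt B BB.
have detB (f : {ffun 'I_d -> 'I_n}) : \det (colsub f B) ^+ 2 =
    \det F ^+ 2 * (c f * expR (pairing t (p f))).
  rewrite colsub_scaled !det_mulmx !exprMn -/(c f) det_diag -mulrA; congr (_ * _).
  have [->|cf] := eqVneq (c f) 0; first by rewrite !mul0r.
  have cf_gt0 : 0 < c f by rewrite lt_def cf basis_weight_ge0.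
  rewrite pairingC (pairing_basis_indicator _ cf_gt0).
  rewrite expR_sum -prodrXl; congr (_ * _); apply: eq_bigr => k _.
  by rewrite mxE lamt.
have Z : d`!%:R = \det F ^+ 2 * partition_function c p t.
  have := cauchy_binet_sum B B; rewrite BB det1 mulr1 => ->.
  by rewrite mulr_sumr; apply: eq_bigr => f _; rewrite -expr2 detB.
have fact0 : d`!%:R != 0 :> R by rewrite pnatr_eq0 -lt0n fact_gt0.
have := fact0; rewrite Z mulf_eq0 negb_or => /andP[F0 Z0].
apply/rowP => i; rewrite mxE; apply: (mulfI fact0).
rewrite (leverage_sum i BB) Z [in RHS]mxE summxE mulrA mulfK //.
rewrite mulr_sumr; apply: eq_bigr => f _.
by rewrite detB !mxE -mulrA.
Qed.

Hypotheses (d_gt0 : (0 < d)%N) (A_conf : vector_configuration A)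
  (A_irr : irreducible_configuration A).

Let A_nz : nonzero_cols A. Proof. by case: A_conf. Qed.

Definition scaled_gram t : 'M[R]_d :=
  A *m diag_mx (\row_i expR (t 0 i)) *m A^T.

Lemma posdef_scaled_gram t : posdef (scaled_gram t).
Proof.
split=> [|x x0].
  by rewrite /scaled_gram !trmx_mul trmxK tr_diag_mx mulmxA.
pose y := x *m A.
have -> : (x *m scaled_gram t *m x^T) 0 0 = \sum_i expR (t 0 i) * y 0 i ^+ 2.
  rewrite /scaled_gram !mulmxA -/y -(mulmxA (y *m _)) -trmx_mul -/y mul_mx_diag.
  by rewrite mxE; apply: eq_bigr => i _; rewrite !mxE -/(y 0 i) expr2 mulrAC mulrC.
have term_ge0 i : 0 <= expR (t 0 i) * y 0 i ^+ 2 by rewrite mulr_ge0 ?expR_ge0 ?sqr_ge0.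
rewrite lt_def sumr_ge0 // andbT psumr_eq0 //; apply: contraNN x0 => /allP y0.
have [_ _ spanA] := A_conf.
apply/eqP; apply: (spanning_annihilator spanA) => _ /fintype.imageP[i _ ->].
have := y0 i (mem_index_enum _); rewrite /= mulf_eq0 gt_eqF ?expR_gt0 //=.
rewrite sqrf_eq0 => /eqP yi0; apply/matrixP => a b; rewrite !ord1 [RHS]mxE -yi0.
by rewrite !mxE; apply: eq_bigr => k _; rewrite mxE.
Qed.

Definition frame_scaling t : 'rV[R]_n := \row_i expR (t 0 i / 2).

Lemma frame_scaling_sqr t i : frame_scaling t 0 i ^+ 2 = expR (t 0 i).
Proof. by rewrite mxE expr2 -expRD -splitr. Qed.

Lemma frame_scaling_neq0 t i : frame_scaling t 0 i != 0.
Proof. by rewrite mxE gt_eqF ?expR_gt0. Qed.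

Lemma frame_gram F (lam t : 'rV[R]_n) : (forall i, lam 0 i ^+ 2 = expR (t 0 i)) ->
  (F *m A *m diag_mx lam) *m (F *m A *m diag_mx lam)^T =
  F *m scaled_gram t *m F^T.
Proof.
move=> lamt; rewrite !trmx_mul tr_diag_mx !mulmxA; congr (_ *m _ *m _).
rewrite -mulmxA mulmx_diag; congr (_ *m diag_mx _).
by apply/rowP => i; rewrite !mxE -expr2 lamt.
Qed.

(** A tight frame obtained by rescaling [A] has Gram determinant 1, so by
Cauchy-Binet not all minors vanish. *)
Lemma exists_basis : exists f, 0 < c f.
Proof.
have [F FP] := continuous_normalizer R d.
have [FMF _] := FP _ (posdef_scaled_gram 0); set M := scaled_gram 0 in FMF.
pose B := F (M) *m A *m diag_mx (frame_scaling 0).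
have BB : B *m B^T = 1%:M by rewrite (frame_gram _ (frame_scaling_sqr 0)).
have := cauchy_binet_sum B B; rewrite BB det1 mulr1 => factE.
apply: contrapT => /forallNP c0.
suff /eqP : d`!%:R = 0 :> R by rewrite pnatr_eq0 -leqn0 leqNgt fact_gt0.
rewrite factE big1 // => f _; rewrite colsub_scaled !det_mulmx.
have := c0 f; rewrite basis_weight_gt0 unitmxE unitfE => /negP/negPn/eqP ->.
by rewrite mulr0 !mul0r.
Qed.

Lemma indicators_separate (u : 'rV[R]_n) (m : R) :
  (forall f, 0 < c f -> pairing (p f) u = m) -> exists a, u = const_mx a.
Proof. exact: (irreducible_separating d_gt0 A_nz A_irr exists_basis). Qed.

Lemma frame_logarithm B : projectively_equivalent A B -> exists F (lam t : 'rV[R]_n),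
  [/\ F \in unitmx, forall i, lam 0 i != 0, forall i, lam 0 i ^+ 2 = expR (t 0 i)
    & B = F *m A *m diag_mx lam].
Proof.
move=> /projectively_equivalentP[F [lam [Fu lam0 ->]]].
exists F, lam, (\row_i ln (lam 0 i ^+ 2)); split=> // i.
by rewrite mxE lnK // posrE exprn_even_gt0 //= lam0.
Qed.

Lemma weight_relative_interior B : projectively_equivalent A B -> V1 B ->
  relative_interior (base_polytope A) (\row_i weight B i).
Proof.
move=> AB /V1P BB; have [F [lam [t [Fu lam0 lamt BE]]]] := frame_logarithm AB.
rewrite BE in BB *; rewrite (weight_moment_map lamt BB) base_polytopeE.
have Z0 := partition_function_gt0 p (basis_weight_ge0 A) exists_basis t.
set Z := partition_function _ _ _ in Z0.
have -> : moment_map c p t =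
    \sum_(f | 0 < c f) (Z^-1 * (c f * expR (pairing t (p f)))) *: p f.
  rewrite /moment_map scaler_sumr [RHS]big_mkcond; apply: eq_bigr => f _.
  case: ifPn => [_|]; first by rewrite scalerA.
  rewrite lt_def basis_weight_ge0 andbT negbK => /eqP ->.
  by rewrite mul0r scale0r scaler0.
apply: positive_combination_relative_interior => [f cf|].
  by rewrite mulr_gt0 ?invr_gt0 // mulr_gt0 ?expR_gt0.
rewrite -mulr_sumr (_ : \sum_(f | 0 < c f) _ = Z) ?mulVf ?gt_eqF //.
rewrite big_mkcond; apply: eq_bigr => f _; case: ifPn => //.
by rewrite lt_def basis_weight_ge0 andbT negbK => /eqP ->; rewrite mul0r.
Qed.

(** Equal weights make the logarithms [t] and [t'] of the scalings differ by a
constant [a], so up to signs the scalings differ by the factor [exp (a / 2)],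
which can be moved to the linear map; the resulting map [G] between the frames
is then orthogonal because both frames are tight. *)
Lemma frame_determined_by_weights B C :
  projectively_equivalent A B -> projectively_equivalent A C ->
  V1 B -> V1 C -> (forall i, weight B i = weight C i) ->
  orthogonally_equivalent B C.
Proof.
move=> AB AC /V1P BB /V1P CC wBC.
have [F [lam [t [Fu lam0 lamt BE]]]] := frame_logarithm AB.
have [F' [lam' [t' [Fu' lam0' lamt' CE]]]] := frame_logarithm AC.
have mtt' : moment_map c p t' = moment_map c p t.
  have <- : \row_i weight B i = moment_map c p t.
    by rewrite BE; apply: weight_moment_map; rewrite // -BE.
  have <- : \row_i weight C i = moment_map c p t'.
    by rewrite CE; apply: weight_moment_map; rewrite // -CE.
  by apply/rowP => i; rewrite !mxE wBC.
have [a ttE] : exists a, t' - t = const_mx a.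
  apply: (indicators_separate (m := pairing (moment_map c p t) (t' - t))).
  apply: (moment_map_monotone_eq (basis_weight_ge0 A) exists_basis).
  by rewrite (addrC t) subrK mtt' subrr pairing0l.
pose e := expR (a / 2).
have e0 : e != 0 by rewrite gt_eqF ?expR_gt0.
have lamE i : lam' 0 i ^+ 2 = (e * lam 0 i) ^+ 2.
  rewrite lamt' exprMn lamt expr2 -expRD -splitr -expRD; congr expR.
  by rewrite -[LHS](subrK (t 0 i)); have /rowP/(_ i) := ttE; rewrite !mxE => ->.
pose eps i := lam' 0 i / (e * lam 0 i).
have el0 i : e * lam 0 i != 0 by rewrite mulf_neq0.
have eps2 i : eps i ^+ 2 = 1.
  by rewrite expr_div_n lamE divff // sqrf_eq0.
pose G := e *: (F' *m invmx F).
have CBE : C = G *m B *m diag_mx (\row_i eps i).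
  have -> : G *m B = e *: (F' *m A *m diag_mx lam).
    by rewrite -scalemxAl BE !mulmxA mulmxKV.
  rewrite CE -scalemxAl; apply/matrixP => k i.
  rewrite mul_mx_diag [RHS]mxE mul_mx_diag [in RHS]mxE mul_mx_diag !mxE /eps.
  by field; rewrite e0 lam0.
clearbody G; exists eps, G; split=> [i||i].
- by have /eqP := eps2 i; rewrite sqrf_eq1 => /orP[] /eqP ->; [left | right].
- apply: mulmx1C; rewrite -CC CBE !trmx_mul tr_diag_mx !mulmxA.
  rewrite -(mulmxA (G *m B)) mulmx_diag.
  rewrite (_ : \row_i _ = const_mx 1); last first.
    by apply/rowP => i; rewrite !mxE -expr2 eps2.
  by rewrite diag_const_mx mulmx1 -(mulmxA G) BB mulmx1.
- rewrite CBE; apply/colP => k; rewrite mul_mx_diag !mxE mulrC.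
  by congr (_ * _); apply: eq_bigr => l _; rewrite mxE.
Qed.

End Frames.

(** * The homeomorphism *)

Section Moduli.
Variables (R : realType) (d n : nat) (A : 'M[R]_(d, n)).
Hypotheses (d_gt0 : (0 < d)%N) (A_conf : vector_configuration A)
  (A_irr : irreducible_configuration A).
Implicit Types (B C : 'M[R]_(d, n)) (t w : 'rV[R]_n).

Notation c := (basis_weight A).
Notation p := (@basis_indicator R d n).
Notation ones := (const_mx 1 : 'rV[R]_n).

Let A_nz : nonzero_cols A. Proof. by case: A_conf. Qed.
Let A_np : nonproportional_cols A. Proof. by case: A_conf. Qed.

Lemma pairing_indicator_ones f : 0 < c f -> pairing (p f) ones = d%:R.
Proof.
move=> cf; rewrite (pairing_basis_indicator _ cf).
by under eq_bigr do rewrite mxE; rewrite sumr_const card_ord.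
Qed.

Lemma exists_logarithm w : relative_interior (base_polytope A) w ->
  exists t, moment_map c p t = w /\ gauged_moment_map c p t = w.
Proof.
rewrite base_polytopeE => wP.
have [|f cf|u up f cf|t [tw t1]] := @moment_map_surjective R n _ c p
    (basis_weight_ge0 A) (exists_basis A_conf) _ w.
- exact: indicators_separate.
- rewrite pairing_indicator_ones //; case: wP => -[k [q [a [Sq _ a1 ->]]] _].
  apply/esym; apply: (affine_hull_pairing (S := [set p f | f in [set f | 0 < c f]])).
    by move=> _ [g cg <-]; exact: pairing_indicator_ones.
  by exists k, q, a.
- apply: (relative_interior_supporting wP) => [_ [g cg <-]|]; first exact: up.
  by exists f.
by exists t; split=> //; rewrite /gauged_moment_map t1 scale0r addr0.
Qed.

(** A section of the map from tight frames to their weights: invert the moment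
map, then normalize. *)
Lemma frame_section : exists frame : 'rV[R]_n -> 'M[R]_(d, n),
  (forall w, relative_interior (base_polytope A) w ->
    [/\ V1 (frame w), projectively_equivalent A (frame w) &
      \row_i weight (frame w) i = w]) /\
  (forall (X : set 'rV[R]_n), X `<=` relative_interior (base_polytope A) ->
    continuous (fun x : set_type X => frame (set_val x))).
Proof.
have [F FP] := continuous_normalizer R d.
have /choice[tau tauP] w : exists t, relative_interior (base_polytope A) w ->
    moment_map c p t = w /\ gauged_moment_map c p t = w.
  have [/exists_logarithm[t tw]|wN] := pselect (relative_interior (base_polytope A) w).
    by exists t.
  by exists 0.
pose frame w := F (scaled_gram A (tau w)) *m A *m diag_mx (frame_scaling (tau w)).
have frameK w : frame w *m (frame w)^T = 1%:M.
  rewrite (frame_gram _ _ (frame_scaling_sqr _)).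
  exact: (FP _ (posdef_scaled_gram A_conf _)).1.
exists frame; split=> [w wP|X XP x].
  split; first exact/V1P/frameK.
    apply/projectively_equivalentP.
    exists (F (scaled_gram A (tau w))), (frame_scaling (tau w)).
    split=> // [|i]; last exact: frame_scaling_neq0.
    have := (FP _ (posdef_scaled_gram A_conf (tau w))).1.
    by rewrite -mulmxA => /mulmx1_unit[].
  rewrite -[RHS](tauP w wP).1; apply: weight_moment_map; last exact: frameK.
  exact: frame_scaling_sqr.
have Xx : relative_interior (base_polytope A) (set_val x) by apply/XP/set_valP.
have tau_cvg : tau (set_val y) @[y --> x] --> tau (set_val x).
  apply/(cvgrPdist_lt (F := nbhs x)) => e e0.
  have [delta delta0 tau_delta] := monotone_inverse_continuous
    (@continuous_gauged_moment_map _ _ _ _ p (basis_weight_ge0 A) (exists_basis A_conf))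
    (gauged_moment_map_strict (basis_weight_ge0 A) (exists_basis A_conf)
      (indicators_separate d_gt0 A_conf A_irr)) (tau (set_val x)) e0.
  have val_cvg : set_val y @[y --> x] --> set_val x by exact: initial_continuous.
  have /(cvgrPdist_lt (F := nbhs x))/(_ delta delta0) := val_cvg.
  apply: (@filterS _ (nbhs x)) => y xy; rewrite distrC; apply: tau_delta.
  have Xy : relative_interior (base_polytope A) (set_val y) by apply/XP/set_valP.
  by rewrite (tauP _ Xx).2 (tauP _ Xy).2 distrC.
have exp_cvg (k : R) i : expR (tau (set_val y) 0 i * k) @[y --> x] -->
    expR (tau (set_val x) 0 i * k).
  have ti_cvg : tau (set_val y) 0 i @[y --> x] --> tau (set_val x) 0 i.
    exact: cvg_entry tau_cvg.
  have tik_cvg : tau (set_val y) 0 i * k @[y --> x] --> tau (set_val x) 0 i * k.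
    exact: (cvgM ti_cvg (cvg_cst k)).
  exact: (@cvg_comp _ _ _ _ _ _ _ _ tik_cvg (@continuous_expR R _)).
have diag_cvg (k : R) : diag_mx (\row_i expR (tau (set_val y) 0 i * k)) @[y --> x] -->
    diag_mx (\row_i expR (tau (set_val x) 0 i * k)).
  apply: (cvg_mx (F := nbhs x)) => i j.
  have entryE w : diag_mx (\row_i expR (tau w 0 i * k)) i j =
      expR (tau w 0 j * k) *+ (i == j) by rewrite !mxE; case: eqP => [->|].
  under eq_fun do rewrite entryE; rewrite entryE.
  by apply: (@cvgMn _ _ _ (nbhs x) _ _ (i == j)); exact: exp_cvg.
have gram_cvg : scaled_gram A (tau (set_val y)) @[y --> x] -->
    scaled_gram A (tau (set_val x)).
  have scaled_gramE t : scaled_gram A t = A *m diag_mx (\row_i expR (t 0 i * 1)) *m A^T.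
    by congr (_ *m diag_mx _ *m _); apply/rowP => i; rewrite !mxE mulr1.
  under eq_fun do rewrite scaled_gramE; rewrite scaled_gramE.
  exact: (cvg_mulmx (cvg_mulmx (cvg_cst _) (diag_cvg 1)) (cvg_cst _)).
have F_cvg := @cvg_comp _ _ _ _ _ _ _ _ gram_cvg (FP _ (posdef_scaled_gram A_conf _)).2.
exact: (cvg_mulmx (cvg_mulmx F_cvg (cvg_cst _)) (diag_cvg 2^-1)).
Qed.

Definition weight_region : set 'rV[R]_n := relative_interior (base_polytope A) `&`
  form_kernel (hirzebruch_form (dual_arrangement A)).

Lemma projectively_equivalent_configuration B : projectively_equivalent A B ->
  nonzero_cols B /\ nonproportional_cols B.
Proof.
move=> [F [lam [Fu lam0 BE]]]; split=> [i|i j ij a]; rewrite BE.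
  rewrite scaler_eq0 negb_or lam0 /=; apply: contraNneq (A_nz i) => FA0.
  by apply/eqP; apply: (can_inj (mulKmx Fu)); rewrite FA0 mulmx0.
rewrite BE; apply: contraNneq (A_np ij ((lam i)^-1 * a * lam j)) => colE.
apply/eqP; apply: (can_inj (mulKmx Fu)); rewrite -scalemxAr -!scalerA -colE.
by rewrite scalerA mulVf ?scale1r.
Qed.

Lemma weight_in_region B :
  vee_systems_equiv_to A B -> weight_region (\row_i weight B i).
Proof.
move=> [Bvee AB]; have [B_nz B_np BV1 _ _] := Bvee; split.
  exact: weight_relative_interior.
exact/(form_kernel_vee d_gt0 A_nz A_np AB BV1 B_nz B_np).
Qed.

Lemma weight_orthogonally_equivalent B C : orthogonally_equivalent B C ->
  forall i, weight B i = weight C i.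
Proof.
move=> [eps [G [eps1 GG CE]]] i; rewrite /weight CE dotZl dotZr mulrA -expr2.
rewrite (_ : eps i ^+ 2 = 1) ?mul1r; last first.
  by case: (eps1 i) => ->; rewrite ?sqrrN expr1n.
by rewrite !dotE trmx_mul -mulmxA (mulmxA G^T) GG mul1mx.
Qed.

Lemma continuous_weights : continuous (fun B => \row_i weight B i).
Proof.
move=> B; apply: (cvg_mx (F := nbhs B)) => i j.
under eq_fun do rewrite mxE; rewrite mxE.
have entry_cvg k : col j C k 0 @[C --> B] --> col j B k 0.
  by under eq_fun do rewrite mxE; rewrite mxE; exact: coord_continuous.
apply: (@cvg_sumr R R^o _ _ (nbhs B) _ _ (fun k C => col j C k 0 * col j C k 0)) => k.
exact: (cvgM (entry_cvg k) (entry_cvg k)).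
Qed.

Local Open Scope quotient_scope.

(** The weights of a representative and the class of the frame with given weights
are mutually inverse. *)
Lemma moduli_homeomorphic : homeomorphic (moduli_space A) (set_type weight_region).
Proof.
have [frame [frameP frame_cont]] := frame_section.
have frame_vee w : weight_region w -> vee_systems_equiv_to A (frame w).
  move=> [wP wQ]; have [BV1 AB wE] := frameP w wP; split=> //.
  have [B_nz B_np] := projectively_equivalent_configuration AB.
  by apply/(form_kernel_vee d_gt0 A_nz A_np AB BV1 B_nz B_np); rewrite wE.
pose to_region (B : set_type (vee_systems_equiv_to A)) : set_type weight_region :=
  exist (fun w => w \in weight_region) _
    (mem_set (weight_in_region (set_valP B))).
pose of_region (w : set_type weight_region) : set_type (vee_systems_equiv_to A) :=
  exist (fun B => B \in vee_systems_equiv_to A) _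
    (mem_set (frame_vee _ (set_valP w))).
pose f (q : moduli_space A) := to_region (repr q).
pose g (w : set_type weight_region) : moduli_space A :=
  \pi_(moduli_space A) (of_region w).
have relP (B C : set_type (vee_systems_equiv_to A)) :
    orthogonally_equivalent (set_val B) (set_val C) ->
    \pi_(moduli_space A) B = \pi_(moduli_space A) C.
  by move=> BC; apply/eqmodP; apply/asboolP.
have reprP (B : set_type (vee_systems_equiv_to A)) :
    orthogonally_equivalent (set_val (repr (\pi_(moduli_space A) B))) (set_val B).
  by apply/asboolP; apply/(eqmodP (moduli_equiv A)); rewrite reprK.
exists f, g; split.
- apply/quotient_continuous.
  rewrite (_ : f \o _ = to_region); last first.
    apply/funext => B; apply: val_inj; apply/rowP => i; rewrite !mxE.
    exact: (weight_orthogonally_equivalent (reprP B) i).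
  apply: continuous_comp_initial => B.
  have val_cvg : set_val C @[C --> B] --> set_val B by exact: initial_continuous.
  exact: (@cvg_comp _ _ _ _ _ _ _ _ val_cvg (@continuous_weights (set_val B))).
- move=> w; apply: continuous_comp; last exact: pi_continuous.
  apply: continuous_comp_initial => {}w; apply: frame_cont => w' [].
  by [].
- move=> q; rewrite -[RHS]reprK; apply: relP.
  have [/= _ rqA] := set_valP (repr q); have [_ _ rqV1 _ _] := (set_valP (repr q)).1.
  have [wP _] := weight_in_region (set_valP (repr q)).
  have [BV1 AB wE] := frameP _ wP.
  apply: (frame_determined_by_weights d_gt0 A_conf A_irr AB rqA BV1 rqV1) => i.
  by have /rowP/(_ i) := wE; rewrite !mxE.
- move=> w; apply: val_inj; apply/rowP => i; rewrite mxE.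
  rewrite (weight_orthogonally_equivalent (reprP _)).
  have [wP _] := set_valP w; have [_ _ /rowP/(_ i)] := frameP _ wP.
  by rewrite mxE.
Qed.

End Moduli.

Lemma affine_hull_form_kernel (R : realType) d n (A : 'M[R]_(d, n)) :
  nonzero_cols A -> nonproportional_cols A ->
  affine_hull (form_kernel (hirzebruch_form (dual_arrangement A))) `<=`
  form_kernel (hirzebruch_form (dual_arrangement A)).
Proof.
move=> A_nz A_np u uK; apply/form_kernel_hirzebruch => // i.
apply: affine_hull_pairing uK => v.
by move=> /(form_kernel_hirzebruch A_nz A_np)/(_ i).
Qed.

Lemma convex_hull0 (R : realType) n : convex_hull (set0 : set 'rV[R]_n) = set0.
Proof.
apply/seteqP; split=> // x [[|k] [q [a [Sq _ a1 _]]]]; last by have := Sq ord0.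
by move: a1; rewrite big_ord0 => /eqP; rewrite eq_sym oner_eq0.
Qed.

Theorem theorem1p5 (R : realType) (d n : nat) (d_gt0 : (0 < d)%N)
    (A : 'M[R]_(d, n)) (A_conf : vector_configuration A)
    (A_irr : irreducible_configuration A) :
  homeomorphic (moduli_space A)
    (set_type (relative_interior (base_polytope A) `&`
               form_kernel (hirzebruch_form (dual_arrangement A)))) /\
  (exists (m : nat) (P : set 'rV[R]_m), polytope P /\
     homeomorphic (moduli_space A) (set_type (relative_interior P))).
Proof.
have homeo := moduli_homeomorphic d_gt0 A_conf A_irr; split=> //.
have [A_nz A_np _] := A_conf.
have [[w0 [w0P w0K]]|empty] := pselect (weight_region A !=set0); last first.
  exists n, set0; split; first by exists set0; rewrite convex_hull0.
  rewrite (_ : relative_interior _ = weight_region A) //.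
  by apply/seteqP; split=> w; [case | move=> wX; case: empty; exists w].
exists n, (base_polytope A `&` form_kernel (hirzebruch_form (dual_arrangement A))).
split.
  rewrite (_ : form_kernel _ = [set u | forall l,
      l \in [seq hirzebruch_row A i | i : 'I_n] -> pairing u l = 0]); last first.
    apply/seteqP; split=> u /=.
      move=> /(form_kernel_hirzebruch A_nz A_np) uK l.
      by move=> /fintype.imageP[i _ ->].
    move=> uK; apply/form_kernel_hirzebruch => // i; apply: uK.
    by apply/fintype.imageP; exists i.
  by apply: polytope_slices; rewrite base_polytopeE; exact: polytope_fin.
rewrite (relative_interior_slice (affine_hull_form_kernel A_nz A_np) w0P w0K).
exact: homeo.
Qed.
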